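(* Let $\varphi$ be a holomorphic self-map of $\mathbb D$. (i) If $D_\varphi$ is bounded on $\mathcal D_\alpha$ for some $\alpha\in(0,1)$, then $D_\varphi$ is bounded on $\mathcal D_\gamma$ for each $\gamma\in(\alpha,1)$. (ii) If $D_\varphi$ is compact on $\mathcal D_\alpha$ for some $\alpha\in(0,1)$, then $D_\varphi$ is compact on $\mathcal D_\gamma$ for each $\gamma\in(\alpha,1)$.
   Context: $\mathbb D=\{z\in\mathbb C:|z|<1\}$ and $\mathcal H(\mathbb D)$ is the space of complex-valued holomorphic functions on $\mathbb D$. A holomorphic self-map of $\mathbb D$ is a $\varphi\in\mathcal H(\mathbb D)$ with $\varphi(\mathbb D)\subseteq\mathbb D$. For $\alpha\in\mathbb R$, the weighted Dirichlet space $\mathcal D_\alpha$ consists of all $f(z)=\sum_{n\ge0}a_nz^n\in\mathcal H(\mathbb D)$ with $\sum_{n\ge0}(n+1)^{1-\alpha}|a_n|^2<\infty$; it is a Hilbert space with inner product $\langle f,g\rangle_{\mathcal D_\alpha}=\sum_{n\ge0}(n+1)^{1-\alpha}a_n\overline{b_n}$ for $g(z)=\sum_{n\ge0} b_nz^n$. The composition-differentiation operator is $D_\varphi f=f'\circ\varphi$; ''bounded (compact) on $\mathcal D_\alpha$'' means that $D_\varphi$ maps $\mathcal D_\alpha$ into itself as a bounded (compact) linear operator. *)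

(* Defs.v *)
From HB Require Import structures.
From mathcomp Require Import all_boot all_order all_algebra.
From mathcomp Require Import all_classical all_reals all_analysis.
From mathcomp Require Import complex ring.

Set Implicit Arguments.
Unset Strict Implicit.
Unset Printing Implicit Defensive.

Import Order.TTheory GRing.Theory Num.Theory.
Import numFieldNormedType.Exports.
Import ComplexField.Normc.

Local Open Scope classical_set_scope.
Local Open Scope ring_scope.
Local Open Scope complex_scope.

Section HolomorphicOnDisc.
Context (K : numFieldType).

Definition unit_disc : set K := [set z | `|z| < 1].

Definition holomorphic_disc (f : K -> K) :=
  forall z, unit_disc z -> derivable f z 1.

Definition holomorphic_self_map (phi : K -> K) :=
  holomorphic_disc phi /\ forall z, unit_disc z -> unit_disc (phi z).

Definition taylor_disc (f : K -> K) (a : nat -> K) :=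
  forall z, unit_disc z -> [series a n * z ^+ n]_n @ \oo --> f z.

Definition comp_diff (phi f : K -> K) : K -> K := fun z => f^`()%classic (phi z).

Lemma taylor_discD f g a b : taylor_disc f a -> taylor_disc g b ->
  taylor_disc (fun z => f z + g z) (fun n => a n + b n).
Proof.
move=> fa gb z zD; have -> : series (fun n => (a n + b n) * z ^+ n) =
    series (fun n => a n * z ^+ n) + series (fun n => b n * z ^+ n).
  apply/funext => n; rewrite /series/= -[RHS]big_split/=.
  by apply: eq_bigr => i _; rewrite mulrDl.
by apply: cvgD; [exact: fa|exact: gb].
Qed.

Lemma taylor_discZ (k : K) f a :
  taylor_disc f a -> taylor_disc (fun z => k * f z) (fun n => k * a n).
Proof.
move=> fa z zD; have -> : series (fun n => k * a n * z ^+ n) =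
    (fun n => k * series (fun n => a n * z ^+ n) n).
  apply/funext => n; rewrite /series/= big_distrr/=.
  by apply: eq_bigr => i _; rewrite mulrA.
by apply: cvgM; [exact: cvg_cst|exact: fa].
Qed.

Lemma taylor_disc0 : taylor_disc (fun=> 0) (fun=> 0).
Proof.
move=> z zD; rewrite (_ : series _ = fun=> 0); first exact: cvg_cst.
by apply/funext => n; rewrite /series/= big1// => i _; rewrite mul0r.
Qed.

Lemma taylor_disc0_inj (a : nat -> K) :
  taylor_disc (fun=> 0) a -> a = fun=> 0.
Proof.
move=> a0; apply/funext; elim/ltn_ind => k ak.
apply/eqP/negPn/negP => ak0.
pose r : K := 2^-1.
have r0 : 0 < r by rewrite invr_gt0.
have rD : unit_disc r.
  by rewrite /unit_disc/= gtr0_norm// invf_lt1// ltr1n.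
have /cvg_seq_bounded [M [Mr /(_ (M + 1))]] : cvgn (fun n => a n * r ^+ n).
  have /cvg_series_cvg_0 : cvgn (series (fun n => a n * r ^+ n)).
    by apply/cvg_ex; exists 0; exact: a0.
  by move=> h; apply/cvg_ex; exists 0.
rewrite ltrDl ltr01 => /(_ isT) bM.
have {bM} : forall n, `|a n| * r ^+ n <= M + 1.
  move=> n; have := bM n I.
  by rewrite /= normrM normrX (gtr0_norm r0).
move: (M + 1) => {Mr}M aM.
pose c := `|a k| * r ^+ k.
have c0 : 0 < c by rewrite mulr_gt0 ?normr_gt0// exprn_gt0.
have cM : c <= M by exact: aM.
have M0 : 0 < M by exact: lt_le_trans cM.
pose s := c / (4 * M).
have s0 : 0 < s by rewrite divr_gt0// mulr_gt0.
have s4 : s <= 4^-1.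
  by rewrite /s invfM mulrCA ler_piMr// ?invr_ge0// ler_pdivrMr// mul1r.
have s1 : s < 1 by apply: (le_lt_trans s4); rewrite invf_lt1// ltr1n.
have rs0 : 0 < r * s by exact: mulr_gt0.
have rsD : unit_disc (r * s).
  rewrite /unit_disc/= (gtr0_norm rs0) mulr_ilt1 ?ltW//.
  by rewrite /r invf_lt1// ltr1n.
have e0 : 0 < c * s ^+ k / 4 by rewrite divr_gt0// mulr_gt0// exprn_gt0.
have /cvgrPdist_lt/(_ _ e0)[N _ HN] := a0 _ rsD.
have := HN (k.+1 + N)%N (leq_addl _ _).
rewrite /= sub0r normrN /series/= (@big_cat_nat _ _ _ k.+1)//= ?leq_addr//.
rewrite big_nat_recr//= big_nat_cond big1 ?add0r => [|i /andP[/andP[_ ik] _]];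
  last by rewrite ak// mul0r.
have tail n : `|\sum_(k.+1 <= i < k.+1 + n) a i * (r * s) ^+ i| <=
    2 * M * s ^+ k.+1 - 2 * M * s ^+ (k.+1 + n).
  elim: n => [|n IH]; first by rewrite addn0 big_geq// normr0 subrr.
  rewrite addnS big_nat_recr ?leq_addr//=.
  apply: (le_trans (ler_normD _ _)); apply: (le_trans (lerD IH (lexx _))).
  have le1 : `|a (k.+1 + n)%N * (r * s) ^+ (k.+1 + n)| <= M * s ^+ (k.+1 + n).
    rewrite exprMn mulrA normrM normrM !normrX (gtr0_norm r0) (gtr0_norm s0).
    by rewrite ler_pM2r ?exprn_gt0.
  apply: (le_trans (lerD (lexx _) le1)); rewrite (exprSr s (k.+1 + n)).
  set t := s ^+ (k.+1 + n); set u := s ^+ k.+1.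
  rewrite -subr_ge0 (_ : _ - _ = (1 - 2 * s) * (M * t)); last by ring.
  rewrite mulr_ge0 ?mulr_ge0 ?(ltW M0) ?exprn_ge0 ?(ltW s0)// subr_ge0.
  apply: (le_trans (ler_wpM2l _ s4)) => //.
  by rewrite ler_pdivrMr// mul1r ler_nat.
move=> lt1; have lt2 := tail N.
have {lt2} : `|\sum_(k.+1 <= i < k.+1 + N) a i * (r * s) ^+ i| <=
    2 * M * s ^+ k.+1.
  apply: (le_trans lt2); rewrite gerBl; apply: mulr_ge0.
    by apply: mulr_ge0 => //; exact: ltW.
  by rewrite exprn_ge0// ltW.
move: lt1; set S := (X in a k * _ + X) => lt1 le2.
have: c * s ^+ k <= `|a k * (r * s) ^+ k + S| + `|S|.
  rewrite (_ : c * _ = `|(a k * (r * s) ^+ k + S) - S|).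
    by rewrite ler_normB.
  by rewrite addrK normrM normrX (gtr0_norm rs0) [(r * s) ^+ k]exprMn mulrA.
move/le_lt_trans => /(_ _ (ltr_leD lt1 le2)).
rewrite exprSr (_ : _ + _ = (3 / 4) * (c * s ^+ k)).
  rewrite ltr_pMl; last by rewrite mulr_gt0 ?exprn_gt0.
  by rewrite ltr_pdivlMr// mul1r ltr_nat.
have <- : 4 * M * s = c by rewrite /s mulrC divfK// gt_eqF// mulr_gt0.
by field.
Qed.

Lemma taylor_disc_inj f a b : taylor_disc f a -> taylor_disc f b -> a = b.
Proof.
move=> fa fb.
have h : taylor_disc (fun=> 0) (fun n => a n + (-1) * b n).
  rewrite (_ : (fun=> 0) = (fun z => f z + (-1) * f z)); last first.
    by apply/funext => z; rewrite mulN1r subrr.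
  by apply: taylor_discD => //; exact: taylor_discZ.
apply/funext => n; have /(congr1 (@^~ n))/= := taylor_disc0_inj h.
by rewrite mulN1r => /eqP; rewrite subr_eq0 => /eqP.
Qed.

Lemma holomorphic_disc_lin (k : K) f g :
  holomorphic_disc f -> holomorphic_disc g ->
  holomorphic_disc (fun z => k * f z + g z).
Proof.
move=> hf hg z zD.
by apply: derivableD; [apply: derivableZ; exact: hf|exact: hg].
Qed.

Lemma holomorphic_disc0 : holomorphic_disc (fun=> 0).
Proof. by move=> z _; exact: derivable_cst. Qed.

End HolomorphicOnDisc.

Lemma normc_ge0 (R : rcfType) (z : R[i]) : 0 <= normc z.
Proof. by case: z => x y; exact: sqrtr_ge0. Qed.

Lemma normcD (R : rcfType) (z w : R[i]) : normc (z + w) <= normc z + normc w.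
Proof. exact: le_normcD. Qed.

Section DirichletSeries.
Context (R : realType) (alpha : R).
Implicit Types a b : nat -> R[i].

Definition dirichlet_weight (n : nat) : R := n.+1%:R `^ (1 - alpha).

Definition dirichlet_series (a : nat -> R[i]) : R^nat :=
  [series dirichlet_weight n * normc (a n) ^+ 2]_n.

Lemma dirichlet_weight_gt0 n : 0 < dirichlet_weight n.
Proof. by rewrite powR_gt0. Qed.

Lemma dirichlet_term_ge0 a n : 0 <= dirichlet_weight n * normc (a n) ^+ 2.
Proof. by rewrite mulr_ge0 ?sqr_ge0// ltW// dirichlet_weight_gt0. Qed.

Lemma dirichlet_series_ge0 a n : 0 <= dirichlet_series a n.
Proof. by apply: sumr_ge0 => i _; exact: dirichlet_term_ge0. Qed.

Lemma nondecreasing_dirichlet_series a :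
  {homo dirichlet_series a : n m / (n <= m)%N >-> n <= m}.
Proof.
by apply: nondecreasing_series => n _ _; exact: dirichlet_term_ge0.
Qed.

Lemma dirichlet_seriesZ (k : R[i]) a :
  dirichlet_series (fun n => k * a n) =
  (fun n => normc k ^+ 2 * dirichlet_series a n).
Proof.
apply/funext => n; rewrite /dirichlet_series/series/= big_distrr/=.
by apply: eq_bigr => i _; rewrite normcM exprMn mulrCA.
Qed.

Lemma dirichlet_series_minkowski a b n :
  Num.sqrt (dirichlet_series (fun n => a n + b n) n) <=
  Num.sqrt (dirichlet_series a n) + Num.sqrt (dirichlet_series b n).
Proof.
have stepE c m : Num.sqrt (dirichlet_series c m.+1) =
    normc (Num.sqrt (dirichlet_series c m) +i*
           (Num.sqrt (dirichlet_weight m) * normc (c m))).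
  rewrite /normc sqr_sqrtr ?dirichlet_series_ge0// exprMn.
  rewrite sqr_sqrtr ?(ltW (dirichlet_weight_gt0 _))//.
  by rewrite /dirichlet_series seriesSr.
have normc_le (x y x' y' : R) : 0 <= x <= x' -> 0 <= y <= y' ->
    normc (x +i* y) <= normc (x' +i* y').
  move=> /andP[x0 xx'] /andP[y0 yy']; rewrite /normc ler_wsqrtr//.
  by rewrite lerD// ler_sqr ?nnegrE// (le_trans _ xx', le_trans _ yy').
elim: n => [|n IH].
  by rewrite /dirichlet_series/series/= !big_geq// sqrtr0 addr0.
rewrite !stepE; apply: le_trans (normcD _ _) => /=.
apply: normc_le; rewrite ?sqrtr_ge0//= mulr_ge0 ?sqrtr_ge0//=; last first.
  exact: normc_ge0.
by rewrite -mulrDr ler_wpM2l ?sqrtr_ge0// normcD.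
Qed.

Lemma cvg_dirichlet_seriesP a : cvgn (dirichlet_series a) <->
  exists M, forall n, Num.sqrt (dirichlet_series a n) <= M.
Proof.
split=> [ca|[M aM]].
  exists (Num.sqrt (limn (dirichlet_series a))) => n; rewrite ler_wsqrtr//.
  by apply: nondecreasing_cvgn_le => //; exact: nondecreasing_dirichlet_series.
apply: nondecreasing_is_cvgn; first exact: nondecreasing_dirichlet_series.
exists (M ^+ 2) => _ [n _ <-].
rewrite -(sqr_sqrtr (dirichlet_series_ge0 a n)).
by rewrite ler_sqr ?nnegrE ?sqrtr_ge0// (le_trans _ (aM n))// sqrtr_ge0.
Qed.

Lemma cvg_dirichlet_seriesD a b :
  cvgn (dirichlet_series a) -> cvgn (dirichlet_series b) ->
  cvgn (dirichlet_series (fun n => a n + b n)).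
Proof.
move=> /cvg_dirichlet_seriesP[M aM] /cvg_dirichlet_seriesP[N bN].
apply/cvg_dirichlet_seriesP; exists (M + N) => n.
by apply: (le_trans (dirichlet_series_minkowski _ _ _)); exact: lerD.
Qed.

Lemma cvg_dirichlet_seriesZ k a :
  cvgn (dirichlet_series a) -> cvgn (dirichlet_series (fun n => k * a n)).
Proof. by move=> ca; rewrite dirichlet_seriesZ; exact: is_cvgMl_tmp. Qed.

Definition dirichlet_seqnorm a := Num.sqrt (limn (dirichlet_series a)).

Lemma dirichlet_seqnormD a b :
  cvgn (dirichlet_series a) -> cvgn (dirichlet_series b) ->
  dirichlet_seqnorm (fun n => a n + b n) <=
  dirichlet_seqnorm a + dirichlet_seqnorm b.
Proof.
move=> ca cb; rewrite /dirichlet_seqnorm.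
rewrite -[leRHS]ger0_norm ?addr_ge0 ?sqrtr_ge0// -sqrtr_sqr ler_wsqrtr//.
apply: limr_le; first exact: cvg_dirichlet_seriesD.
near=> n; rewrite -(sqr_sqrtr (dirichlet_series_ge0 _ n)).
rewrite ler_sqr ?nnegrE ?addr_ge0 ?sqrtr_ge0//.
apply: (le_trans (dirichlet_series_minkowski _ _ _)).
by apply: lerD; rewrite ler_wsqrtr//; apply: nondecreasing_cvgn_le => //;
  exact: nondecreasing_dirichlet_series.
Unshelve. all: by end_near. Qed.

Lemma dirichlet_seqnormZ k a : cvgn (dirichlet_series a) ->
  dirichlet_seqnorm (fun n => k * a n) = normc k * dirichlet_seqnorm a.
Proof.
move=> ca; rewrite /dirichlet_seqnorm dirichlet_seriesZ.
rewrite limM//; last exact: is_cvg_cst.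
rewrite lim_cst// sqrtrM ?sqr_ge0// sqrtr_sqr ger0_norm//.
exact: normc_ge0.
Qed.

Lemma dirichlet_seqnorm0_eq0 a : cvgn (dirichlet_series a) ->
  dirichlet_seqnorm a = 0 -> a = fun=> 0.
Proof.
move=> ca /eqP; rewrite sqrtr_eq0 => l0; apply/funext => n.
have : dirichlet_weight n * normc (a n) ^+ 2 <= 0.
  apply: le_trans l0; apply: (@le_trans _ _ (dirichlet_series a n.+1)).
    by rewrite /dirichlet_series seriesSr lerDr dirichlet_series_ge0.
  by apply: nondecreasing_cvgn_le => //; exact: nondecreasing_dirichlet_series.
rewrite pmulr_rle0 ?dirichlet_weight_gt0// => an0; apply: eq0_normc.
by apply/eqP; rewrite -sqrf_eq0 eq_le an0 sqr_ge0.
Qed.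

End DirichletSeries.

Section DirichletSpace.
Context (R : realType) (alpha : R).

(* A function on the disc is represented by its extension by 0 to R[i], so that
   two elements of the space are equal as soon as they agree on the disc. *)
Definition dirichlet_set : set (R[i] -> R[i]^o) :=
  [set f | [/\ holomorphic_disc f, forall z, ~ unit_disc z -> f z = 0 &
    exists2 a, taylor_disc f a & cvgn (dirichlet_series alpha a)]].

Definition dirichlet_pred : {pred R[i] -> R[i]^o} := mem dirichlet_set.

Record dirichlet := Dirichlet {
  dirichlet_fun :> R[i] -> R[i]^o ;
  dirichlet_funP : dirichlet_fun \in dirichlet_pred }.

HB.instance Definition _ := [isSub for dirichlet_fun].
HB.instance Definition _ := [Choice of dirichlet by <:].

Lemma dirichlet_submod_closed : submod_closed dirichlet_pred.
Proof.
split=> [|k f g].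
  rewrite inE; split=> //.
  exists (fun=> 0); first exact: (@taylor_disc0 R[i]).
  apply/cvg_dirichlet_seriesP; exists 0 => n.
  rewrite [dirichlet_series _ _ _]big1 ?sqrtr0// => i _.
  change (dirichlet_weight alpha i * normc (0 : R[i]) ^+ 2 = 0).
  by rewrite [normc _]normc0 expr0n mulr0.
move=> /set_mem[hf f0 [a fa ca]] /set_mem[hg g0 [b gb cb]].
apply/mem_set; split.
- exact: holomorphic_disc_lin.
- move=> z zD; change (k * f z + g z = 0).
  by rewrite (f0 z zD) (g0 z zD) mulr0 addr0.
- exists (fun n => k * a n + b n).
    exact (taylor_discD (@taylor_discZ _ k _ _ fa) gb).
  by apply: cvg_dirichlet_seriesD => //; exact: cvg_dirichlet_seriesZ.
Qed.

HB.instance Definition _ := GRing.isSubmodClosed.Build _ _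
  dirichlet_pred dirichlet_submod_closed.
HB.instance Definition _ := [SubChoice_isSubLmodule of dirichlet by <:].

Definition taylor (f : R[i] -> R[i]) : nat -> R[i] := get (taylor_disc f).

Lemma dirichletP (f : dirichlet) : dirichlet_set f.
Proof. by have := dirichlet_funP f; rewrite inE. Qed.

Lemma taylorP (f : dirichlet) : taylor_disc f (taylor f).
Proof. by have [_ _ [a fa _]] := dirichletP f; exact: (getPex (ex_intro _ a fa)). Qed.

Lemma taylorE (f : dirichlet) a : taylor_disc f a -> taylor f = a.
Proof. exact/taylor_disc_inj/taylorP. Qed.

Lemma cvg_dirichlet (f : dirichlet) : cvgn (dirichlet_series alpha (taylor f)).
Proof. by have [_ _ [a /taylorE->]] := dirichletP f. Qed.

Definition dirichlet_norm (f : dirichlet) : R :=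
  dirichlet_seqnorm alpha (taylor f).

Lemma dirichlet_normD f g :
  dirichlet_norm (f + g) <= dirichlet_norm f + dirichlet_norm g.
Proof.
rewrite /dirichlet_norm (@taylorE _ (fun n => taylor f n + taylor g n)).
  by apply: dirichlet_seqnormD; exact: cvg_dirichlet.
exact (taylor_discD (@taylorP f) (@taylorP g)).
Qed.

Lemma dirichlet_normZ (k : R[i]) f :
  dirichlet_norm (k *: f) = normc k * dirichlet_norm f.
Proof.
rewrite /dirichlet_norm (@taylorE _ (fun n => k * taylor f n)).
  by apply: dirichlet_seqnormZ; exact: cvg_dirichlet.
exact (@taylor_discZ _ k _ _ (@taylorP f)).
Qed.

Lemma dirichlet_norm0_eq0 f : dirichlet_norm f = 0 -> f = 0.
Proof.
move=> /(dirichlet_seqnorm0_eq0 (@cvg_dirichlet f)) tf0.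
apply/val_inj/funext => z /=; have [_ f0 _] := dirichletP f.
have [zD|/f0//] := pselect (unit_disc z).
have := @taylorP f; rewrite tf0 => /(_ z zD) fz.
exact (cvg_unique (@norm_hausdorff _ _) fz (@taylor_disc0 _ z zD)).
Qed.

Lemma dirichlet_normMn f n : dirichlet_norm (f *+ n) = dirichlet_norm f *+ n.
Proof.
by rewrite -scaler_nat dirichlet_normZ [normc _]normcMn normc1 mulr_natl.
Qed.

Lemma dirichlet_normN f : dirichlet_norm (- f) = dirichlet_norm f.
Proof. by rewrite -scaleN1r dirichlet_normZ normcN normc1 mul1r. Qed.

(* The norm takes its values in R rather than in R[i]; it makes dirichlet a
   pseudoMetricNormedZmodType R on top of its lmodType R[i] structure, the two
   being related by dirichlet_normZ. *)
HB.instance Definition _ := Num.Zmodule_isNormed.Build R dirichlet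
  dirichlet_normD dirichlet_norm0_eq0 dirichlet_normMn dirichlet_normN.
HB.instance Definition _ :=
  PseudoMetric.copy dirichlet (pseudoMetric_normed dirichlet).
HB.instance Definition _ := isPointed.Build dirichlet 0.
HB.instance Definition _ := NormedZmod_PseudoMetric_eq.Build R dirichlet erefl.

End DirichletSpace.

Section Operators.
Context (R : realType) (alpha : R).

Definition bounded_op (T : {linear dirichlet alpha -> dirichlet alpha}) :=
  exists M : R, forall f, `|T f| <= M * `|f|.

Definition compact_op (T : {linear dirichlet alpha -> dirichlet alpha}) :=
  forall A : set (dirichlet alpha), bounded_set A -> precompact (T @` A).

Definition represents_comp_diff (phi : R[i] -> R[i])
    (T : {linear dirichlet alpha -> dirichlet alpha}) :=
  forall f z, unit_disc z -> T f z = comp_diff phi f z.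

Definition comp_diff_bounded (phi : R[i] -> R[i]) :=
  exists2 T, represents_comp_diff phi T & bounded_op T.

Definition comp_diff_compact (phi : R[i] -> R[i]) :=
  exists2 T, represents_comp_diff phi T & compact_op T.

End Operators.

(* Main.v *)
From HB Require Import structures.
Require Import Defs.
From mathcomp Require Import all_boot all_order all_algebra.
From mathcomp Require Import all_classical all_reals all_analysis.
From mathcomp Require Import complex ring lra zify.

Set Implicit Arguments.
Unset Strict Implicit.
Unset Printing Implicit Defensive.

Import Order.TTheory GRing.Theory Num.Theory.
Import numFieldNormedType.Exports.
Import ComplexField.Normc.

Local Open Scope classical_set_scope.
Local Open Scope ring_scope.
Local Open Scope complex_scope.

(* Let t k n be the k-th Taylor coefficient of n phi^(n - 1), the matrix of
   D_phi.  Boundedness on D_alpha applied to monomials bounds the norm of phi^m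
   in D_alpha, hence, by Cauchy-Schwarz, the sum of the first K absolute
   coefficients of phi^m by C K^(1/2) (m + 1)^(- (1 + alpha) / 2).  These partial
   sums are submultiplicative, so that for k of the order of n the entry t k n
   decays faster than any power of n.  Given f in D_gamma and an output index k
   with 2^j <= k + 1 < 2^(j + 1), the inputs n + 1 >= 2^j contribute a
   Hilbert-Schmidt term by that decay, while the inputs n + 1 < 2^j are handled
   by the bound on D_alpha; the weights being comparable on dyadic blocks, the
   sum over j is geometric because alpha < gamma.  The same estimate for the
   coefficients of index at least L bounds the tails of D_phi f in D_gamma by the
   tails in D_alpha, up to 1 / (L + 1); compactness of D_phi is the uniform
   smallness of these tails on the unit ball. *)

(** * Convergence in [R[i]] through the real-valued modulus *)

Section ComplexConvergence.
Context (R : realType).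
Local Notation C := (R[i] : numFieldType).
Implicit Types (z w : R[i]) (a b : nat -> R[i]).

Lemma normr_normc z : `|z| = (normc z)%:C.
Proof. by []. Qed.

Lemma normcB z w : normc (z - w) = normc (w - z).
Proof. by rewrite -normcN opprB. Qed.

Lemma normc_eq0 z : (normc z == 0) = (z == 0).
Proof.
by apply/eqP/eqP => [/eq0_normc//|->]; rewrite normc0.
Qed.

Lemma normcX z n : normc (z ^+ n) = normc z ^+ n.
Proof.
elim: n => [|n IH]; first by rewrite !expr0 normc1.
by rewrite !exprS normcM IH.
Qed.

Lemma normc_real (x : R) : normc (x%:C : R[i]) = `|x|.
Proof. by rewrite /= expr0n/= addr0 sqrtr_sqr. Qed.

Lemma normc_nat n : normc (n%:R : R[i]) = n%:R :> R.
Proof. by rewrite -[n%:R]/(1 *+ n) normcMn normc1. Qed.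

Lemma normc_sum (I : Type) (r : seq I) (P : pred I) (F : I -> R[i]) :
  normc (\sum_(i <- r | P i) F i) <= \sum_(i <- r | P i) normc (F i).
Proof.
elim/big_rec2 : _ => [|i x y _ IH]; first by rewrite normc0.
by apply: (le_trans (normcD _ _)); rewrite lerD2l.
Qed.

Lemma unit_discE z : @unit_disc C z = (normc z < 1) :> Prop.
Proof. by rewrite /unit_disc/= normr_normc -[1]/(1%:C) ltcR. Qed.

Lemma cvgC_norm (T : Type) (F : set_system T) {FF : Filter F}
    (u : T -> C) (l : C) :
  (u @ F --> l) <-> ((fun x => normc (l - u x)) @ F --> (0 : R)).
Proof.
split=> [/cvgrPdist_lt ul|/cvgrPdist_lt ul]; apply/cvgrPdist_lt => e e0.
  have e0' : 0 < e%:C :> C by rewrite -[0]/(0%:C) ltcR.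
  apply: filterS (ul _ e0') => x /=.
  by rewrite normr_normc ltcR sub0r normrN ger0_norm// normc_ge0.
(* The order on [R[i]] compares only elements with equal imaginary parts, so a positive [e] is
   real. *)
move: e0; rewrite ltcE => /andP[/eqP/= Ime Ree].
apply: filterS (ul _ Ree) => x /=.
rewrite sub0r normrN ger0_norm ?normc_ge0// => h.
by rewrite normr_normc ltcE/= Ime eqxx.
Qed.

Lemma normc_le_Re_Im z : normc (z : R[i]) <= `|complex.Re z| + `|complex.Im z|.
Proof.
case: z => x y /=; rewrite -[leRHS]ger0_norm ?addr_ge0// -sqrtr_sqr.
rewrite ler_wsqrtr// sqrrD !real_normK ?num_real//.
by rewrite lerD2r lerDl mulrn_wge0// mulr_ge0.
Qed.

Lemma normc_Re z : `|complex.Re z| <= normc (z : R[i]).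
Proof. by case: z => x y /=; rewrite -sqrtr_sqr ler_wsqrtr// lerDl sqr_ge0. Qed.

Lemma normc_Im z : `|complex.Im z| <= normc (z : R[i]).
Proof. by case: z => x y /=; rewrite -sqrtr_sqr ler_wsqrtr// lerDr sqr_ge0. Qed.

Lemma cvgC_Re_Im (T : Type) (F : set_system T) {FF : Filter F}
    (u : T -> C) (x y : R) :
  (fun t => complex.Re (u t)) @ F --> x ->
  (fun t => complex.Im (u t)) @ F --> y ->
  u @ F --> (x +i* y : C).
Proof.
move=> ux uy; apply/cvgC_norm; apply/cvgrPdist_le => e e0.
have e2 : 0 < e / 2 by rewrite divr_gt0.
move/cvgrPdist_le : ux => /(_ _ e2) ux; move/cvgrPdist_le : uy => /(_ _ e2) uy.
apply: filterS2 ux uy => t ux uy.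
rewrite sub0r normrN ger0_norm ?normc_ge0//; apply: (le_trans (normc_le_Re_Im _)).
by rewrite [leRHS](splitr e); case: (u t) ux uy => p q /= ux uy; apply: lerD.
Qed.

Lemma cvgC_normc_le (T : Type) (F : set_system T) {FF : ProperFilter F}
    (u : T -> C) (l : C) (B : R) :
  u @ F --> l -> (\forall x \near F, normc (u x) <= B) -> normc l <= B.
Proof.
move=> /cvgC_norm ul uB; apply/ler_addgt0Pr => e e0.
move/cvgrPdist_lt : ul => /(_ _ e0) ul.
have [x [/=]] := filter_ex (filterI ul uB).
rewrite sub0r normrN ger0_norm ?normc_ge0// => lx xB.
rewrite -(subrK (u x) l) addrC; apply: (le_trans (normcD _ _)).
by apply: lerD => //; exact: ltW.
Qed.

Lemma cvgC_sum (T I : Type) (F : set_system T) {FF : Filter F} (r : seq I)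
    (u : I -> T -> C) (l : I -> C) : (forall i, u i @ F --> l i) ->
  (fun x => \sum_(i <- r) u i x) @ F --> \sum_(i <- r) l i.
Proof.
by move=> ul; apply: cvg_big => //; exact: add_continuous.
Qed.

(** Real and imaginary parts are dominated by the modulus, so both series converge absolutely in
    [R]. *)
Lemma cvgC_series (u : nat -> C) (B : R) :
  (forall n, \sum_(0 <= k < n) normc (u k) <= B) ->
  exists l : C, series u @ \oo --> l.
Proof.
move=> uB.
have aux (f : {additive Rcomplex R -> R}) : (forall z : R[i], `|f z| <= normc z) ->
    cvgn (fun n => f (series u n)).
  move=> fu.
  rewrite (_ : (fun _ => _) = series (fun n => f (u n))); last first.
    by apply/funext => n; rewrite /series/= (raddf_sum f).
  apply: normed_cvg; apply: nondecreasing_is_cvgn.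
    by apply: nondecreasing_series => n _ _; exact: normr_ge0.
  exists B => _ [n _ <-]; apply: le_trans (uB n).
  by apply: ler_sum => i _; exact: fu.
have cRe := aux (@complex.Re R : {linear _ -> _}) normc_Re.
have cIm := aux (@complex.Im R : {linear _ -> _}) normc_Im.
eexists; apply: cvgC_Re_Im; [exact: cRe|exact: cIm].
Qed.

End ComplexConvergence.

(** * Geometric sums with polynomial factors *)

Section GeometricSums.
Context (R : realType).
Implicit Types t : R.

Lemma sum_geometric_le t n : 0 <= t < 1 ->
  \sum_(0 <= i < n) t ^+ i <= (1 - t)^-1.
Proof.
move=> /andP[t0 t1]; have t10 : 0 < 1 - t by rewrite subr_gt0.
have -> : \sum_(0 <= i < n) t ^+ i = (1 - t ^+ n) / (1 - t).
  apply/(mulIf (lt0r_neq0 t10)); rewrite divfK ?lt0r_neq0//.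
  elim: n => [|n IH]; first by rewrite big_geq// mul0r expr0 subrr.
  by rewrite big_nat_recr//= mulrDl IH exprSr; ring.
by rewrite ler_piMl ?invr_ge0 ?(ltW t10)// gerBl exprn_ge0.
Qed.

(** The factor [(i + 1)^2] is replaced by [(i + 1) (i + 2)], whose partial sums against [t^i] equal
    [2 / (1 - t)^3] minus an explicit nonnegative remainder. *)
Lemma sum_sqr_geometric_bounded t : 0 <= t < 1 ->
  exists B, forall n, \sum_(0 <= i < n) i.+1%:R ^+ 2 * t ^+ i <= B.
Proof.
move=> /andP[t0 t1]; have t10 : 0 < 1 - t by rewrite subr_gt0.
exists (2 / (1 - t) ^+ 3) => n; rewrite ler_pdivlMr ?exprn_gt0//.
apply: (@le_trans _ _
    ((\sum_(0 <= i < n) (i.+1%:R * i.+2%:R) * t ^+ i) * (1 - t) ^+ 3)).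
  rewrite ler_wpM2r ?exprn_ge0 ?(ltW t10)// ler_sum// => i _.
  by rewrite ler_wpM2r ?exprn_ge0// ler_wpM2l// ler_nat.
have -> : (\sum_(0 <= i < n) (i.+1%:R * i.+2%:R) * t ^+ i) * (1 - t) ^+ 3 =
    2 - (n%:R ^+ 2 * (1 - t) ^+ 2 + n%:R * ((1 - t) * (2 + (1 - t))) + 2)
        * t ^+ n.
  elim: n => [|n IH]; first by rewrite big_geq//= expr0; ring.
  by rewrite big_nat_recr//= mulrDl IH (exprSr t n) -(natr1 n.+1) -(natr1 n); ring.
rewrite gerBl mulr_ge0 ?exprn_ge0// !addr_ge0//.
  by apply: mulr_ge0; exact: sqr_ge0.
apply: mulr_ge0 => //; apply: mulr_ge0; first exact: ltW.
by apply: addr_ge0 => //; exact: ltW.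
Qed.

(** A single term [(n + 1)^2 t^n] is bounded by some [B], hence [n t^n] is at most [B / (n + 1)]. *)
Lemma cvg_natM_geometric t : 0 <= t < 1 ->
  (fun n => n%:R * t ^+ n) @ \oo --> (0 : R).
Proof.
move=> t01; have [B tB] := sum_sqr_geometric_bounded t01.
have /andP[t0 _] := t01.
have tB' n : n%:R * t ^+ n <= B / n.+1%:R.
  rewrite ler_pdivlMr//; apply: le_trans (tB n.+1).
  rewrite big_nat_recr//= -[leLHS]add0r lerD//.
    by apply: sumr_ge0 => i _; rewrite mulr_ge0 ?exprn_ge0.
  by rewrite mulrAC ler_wpM2r ?exprn_ge0// ler_wpM2r// ler_nat.
apply: (squeeze_cvgr (f := fun=> 0) (h := fun n => B / n.+1%:R)).
- by near=> n; rewrite tB' mulr_ge0 ?exprn_ge0.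
- exact: cvg_cst.
- rewrite -[X in _ --> X](mulr0 B).
  by apply: cvgM; [exact: cvg_cst|exact: cvg_harmonic].
Unshelve. all: by end_near. Qed.

End GeometricSums.

(** * Cauchy products and power series with bounded coefficients *)

Definition cauchy_prod (K : comNzRingType) (a b : nat -> K) n :=
  \sum_(0 <= i < n.+1) a i * b (n - i)%N.

(** Both sides sum over the triangle [i + j < n], by diagonals on the left and by rows on the
    right. *)
Lemma sum_cauchy_prod (K : comNzRingType) (a b : nat -> K) z n :
  \sum_(0 <= k < n) cauchy_prod a b k * z ^+ k =
  \sum_(0 <= i < n) a i * z ^+ i * \sum_(0 <= j < n - i) b j * z ^+ j.
Proof.
elim: n => [|n IH]; first by rewrite !big_geq.
rewrite big_nat_recr//= IH [RHS]big_nat_recr//= subSnn big_nat1.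
rewrite [in LHS]/cauchy_prod big_nat_recr//= mulrDl subnn expr0 addrA.
congr (_ + _); last by ring.
rewrite mulr_suml -big_split/= big_nat [RHS]big_nat; apply: eq_bigr => i /andP[_ ilt].
rewrite subSn ?(ltnW ilt)// big_nat_recr//= mulrDr; congr (_ + _).
by rewrite mulrACA -exprD subnKC// ltnW.
Qed.

Section BoundedPowerSeries.
Context (R : realType).
Local Notation C := (R[i] : numFieldType).
Implicit Types (z w : R[i]) (a b : nat -> R[i]) (f g : R[i] -> R[i]) (M r : R).

Definition coef_bounded (M : R) (a : nat -> R[i]) := forall n, normc (a n) <= M.

Lemma coef_bounded_ge0 M a : coef_bounded M a -> 0 <= M.
Proof. by move=> /(_ 0%N); apply: le_trans; exact: normc_ge0. Qed.

Lemma sum_coef_geometric_le M a z m n : coef_bounded M a -> normc z < 1 ->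
  \sum_(m <= k < m + n) normc (a k * z ^+ k) <= M * normc z ^+ m / (1 - normc z).
Proof.
move=> aM z1; have M0 := coef_bounded_ge0 aM.
apply: (@le_trans _ _ (\sum_(0 <= i < n) M * normc z ^+ m * normc z ^+ i)).
  rewrite -{1}[m]add0n big_addn addKn; apply: ler_sum => i _.
  rewrite normcM normcX exprD [normc z ^+ i * _]mulrC -mulrA.
  by rewrite ler_wpM2r// ?mulr_ge0 ?exprn_ge0 ?normc_ge0.
rewrite -mulr_sumr; apply: ler_wpM2l.
  by rewrite mulr_ge0 ?exprn_ge0 ?normc_ge0.
by apply: sum_geometric_le; rewrite normc_ge0.
Qed.

Lemma taylor_disc_exists M a : coef_bounded M a ->
  exists f : C -> C, taylor_disc f a.
Proof.
move=> aM.
have h z : exists l : C, unit_disc (z : C) -> series (fun n => a n * z ^+ n) @ \oo --> l.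
  have [zD|zD] := pselect (unit_disc (z : C)); last by exists 0.
  have [l zl] : exists l : C, series (fun n => a n * z ^+ n : C) @ \oo --> l.
    apply: (@cvgC_series _ _ (M * normc z ^+ 0 / (1 - normc z))) => n.
    rewrite -[n]add0n; apply: sum_coef_geometric_le => //.
    by rewrite unit_discE in zD.
  by exists l.
by have [f fP] := choice h; exists f => z zD; exact: fP.
Qed.

(** The geometric remainder turns the expansion into inequalities that involve finitely many
    coefficients each, a form stable under pointwise limits. *)
Lemma taylor_discP M (f : C -> C) a : coef_bounded M a ->
  taylor_disc f a <-> forall z n, normc z < 1 ->
    normc (f z - \sum_(0 <= k < n) a k * z ^+ k) <=
      M * normc z ^+ n / (1 - normc z).
Proof.
move=> aM; split=> [fa z n z1|fa z zD].
  apply: (@cvgC_normc_le _ _ \oo _ (fun N => series (fun k => a k * z ^+ k) N -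
     \sum_(0 <= k < n) a k * z ^+ k : C)).
    apply: (@cvgB _ C); last exact: (@cvg_cst C).
    by apply: (fa z); rewrite unit_discE.
  near=> N; have nN : (n <= N)%N by near: N; exact: nbhs_infty_ge.
  rewrite /series/= (@big_cat_nat _ _ _ n)//= addrAC subrr add0r.
  by rewrite -(subnKC nN); apply: (le_trans (normc_sum _ _ _));
    exact: sum_coef_geometric_le.
apply/cvgC_norm; rewrite unit_discE in zD.
apply: (squeeze_cvgr (f := fun=> 0)
  (h := fun n => M / (1 - normc z) * normc z ^+ n)).
- by near=> n; rewrite normc_ge0/= mulrAC fa.
- exact: cvg_cst.
- rewrite -[X in _ --> X](mulr0 (M / (1 - normc z))).
  apply: cvgM; first exact: cvg_cst.
  by apply: cvg_expr; rewrite ger0_norm// normc_ge0.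
Unshelve. all: by end_near. Qed.

(** The remainder bound depends on the common [M] alone, so it survives the limit in [N] for each
    fixed [n] and [z]. *)
Lemma taylor_disc_lim M (f_ : nat -> C -> C) (a_ : nat -> nat -> R[i])
    (f : C -> C) a :
  (forall N, taylor_disc (f_ N) (a_ N)) -> (forall N, coef_bounded M (a_ N)) ->
  (forall k, a_ ^~ k @ \oo --> (a k : C)) ->
  (forall z, unit_disc z -> f_ ^~ z @ \oo --> f z) -> taylor_disc f a.
Proof.
move=> fa aM a_a f_f.
have aM' : coef_bounded M a.
  by move=> k; apply: (cvgC_normc_le (a_a k)); near=> N; exact: aM.
apply/(taylor_discP _ aM') => z n z1.
have zD : unit_disc (z : C) by rewrite unit_discE.
apply: (@cvgC_normc_le _ _ \oo _ (fun N => f_ N z -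
   \sum_(0 <= k < n) a_ N k * z ^+ k : C)); last first.
  by near=> N; have h := (taylor_discP (f_ N) (aM N)).1 (fa N) z n z1; exact h.
apply: (@cvgB _ C); first exact: f_f.
apply: cvgC_sum => k; apply: (@cvgM C); first exact: a_a.
exact: cvg_cst.
Unshelve. all: by end_near. Qed.

Lemma taylor_discM Ma Mb (f g : C -> C) a b :
  coef_bounded Ma a -> coef_bounded Mb b ->
  taylor_disc f a -> taylor_disc g b ->
  taylor_disc (fun z => f z * g z) (cauchy_prod a b).
Proof.
move=> aM bM fa gb z zD; have zD' := zD; rewrite unit_discE in zD'.
have gP := (taylor_discP _ bM).1 gb z ^~ zD'.
rewrite /=; set c := (X in series (fun n => X n * _)).
(* A partial sum of the Cauchy product is a triangle; completing its rows by the tails of [g] costs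
   at most a constant times [n |z|^n], which tends to 0. *)
have -> : series (fun n => c n * z ^+ n) =
  (fun n => series (fun k => a k * z ^+ k) n * g z -
    \sum_(0 <= i < n) a i * z ^+ i *
      (g z - \sum_(0 <= j < n - i) b j * z ^+ j)).
  apply/funext => n; rewrite /series/= sum_cauchy_prod.
  by under [X in _ - X]eq_bigr do rewrite mulrBr; rewrite sumrB -mulr_suml opprB addrC subrK.
rewrite -[X in _ --> X]subr0; apply: (@cvgB _ C).
  by apply: (@cvgM C); [exact: fa|exact: cvg_cst].
apply/cvgC_norm.
apply: (squeeze_cvgr (f := fun=> 0)
  (h := fun n => Ma * Mb / (1 - normc z) * (n%:R * normc z ^+ n))).
- near=> n; rewrite normc_ge0/= sub0r normcN.
  apply: (le_trans (normc_sum _ _ _)).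
  apply: (@le_trans _ _ (\sum_(0 <= i < n) Ma * Mb / (1 - normc z) * normc z ^+ n)).
    rewrite big_nat [leRHS]big_nat; apply: ler_sum => i /andP[_ ilt].
    have -> : normc z ^+ n = normc z ^+ i * normc z ^+ (n - i).
      by rewrite -exprD subnKC// ltnW.
    rewrite (_ : Ma * _ / _ * _ = (Ma * normc z ^+ i) *
      (Mb * normc z ^+ (n - i) / (1 - normc z))); last by ring.
    rewrite normcM; apply: ler_pM; rewrite ?normc_ge0// normcM normcX.
    by apply: ler_wpM2r => //; rewrite exprn_ge0 ?normc_ge0.
  by rewrite sumr_const_nat subn0 -mulr_natl; lra.
- exact: cvg_cst.
- rewrite -[X in _ --> X](mulr0 (Ma * Mb / (1 - normc z))).
  apply: cvgM; first exact: cvg_cst.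
  by apply: cvg_natM_geometric; rewrite normc_ge0.
Unshelve. all: by end_near. Qed.

(** Second-order Taylor remainder of a power, by induction on the exponent. The factor [rho ^+ 2] on
    the left avoids the exponent [n - 1], and the loose factor [(n + 1)^2] absorbs the increment
    since [(n + 1)^2 + (n + 1) <= (n + 2)^2]. *)
Lemma exprD_taylor2_le z h (rho : R) n :
  normc z <= rho -> normc (z + h) <= rho ->
  rho ^+ 2 * normc ((z + h) ^+ n.+1 - z ^+ n.+1 - n.+1%:R * h * z ^+ n) <=
    normc h ^+ 2 * (n.+1%:R ^+ 2 * rho ^+ n.+1).
Proof.
move=> zr zhr; have r0 : 0 <= rho by exact: le_trans (normc_ge0 z) zr.
elim: n => [|n IH].
  rewrite !expr1 expr0 mulr1 mul1r (_ : _ - _ - _ = 0); last by ring.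
  by rewrite normc0 mulr0 !mulr_ge0 ?exprn_ge0 ?normc_ge0.
rewrite (_ : _ - _ - _ =
  (z + h) * ((z + h) ^+ n.+1 - z ^+ n.+1 - n.+1%:R * h * z ^+ n) +
    n.+1%:R * h ^+ 2 * z ^+ n); last first.
  by rewrite -(natr1 n.+1) !exprS; ring.
have h1 : normc (n.+1%:R * h ^+ 2 * z ^+ n) <= n.+1%:R * normc h ^+ 2 * rho ^+ n.
  rewrite 2!normcM normc_nat !normcX ler_wpM2l//.
    by rewrite mulr_ge0 ?exprn_ge0 ?normc_ge0.
  by rewrite lerXn2r ?nnegrE ?normc_ge0.
have h2 : rho ^+ 2 * normc ((z + h) *
      ((z + h) ^+ n.+1 - z ^+ n.+1 - n.+1%:R * h * z ^+ n)) <=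
    rho * (normc h ^+ 2 * (n.+1%:R ^+ 2 * rho ^+ n.+1)).
  by rewrite normcM mulrCA; apply: ler_pM; rewrite ?normc_ge0 ?mulr_ge0 ?sqr_ge0 ?normc_ge0.
apply: (le_trans (ler_wpM2l _ (normcD _ _))); first exact: sqr_ge0.
rewrite mulrDr; apply: (le_trans (lerD h2 (ler_wpM2l _ h1))); first exact: sqr_ge0.
rewrite -subr_ge0 (_ : _ - _ = normc h ^+ 2 * rho ^+ n.+2 * n.+2%:R); last first.
  by rewrite -(natr1 n.+1) !exprS; ring.
apply: mulr_ge0 => //; apply: mulr_ge0; first exact: sqr_ge0.
exact: exprn_ge0.
Qed.

(** The quadratic remainders of the powers are summed term by term, with one [K] for all increments
    that stay in the disc of radius [rho]. *)
Lemma taylor_disc_taylor1 M (f : C -> C) a z (rho : R) : coef_bounded M a ->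
  taylor_disc f a -> normc z <= rho < 1 -> 0 < rho ->
  exists d : C, series (fun n => n.+1%:R * a n.+1 * z ^+ n) @ \oo --> d /\
  exists K : R, forall h, normc (z + h) <= rho ->
    normc (f (z + h) - f z - h * d) <= K * normc h ^+ 2.
Proof.
move=> aM fa /andP[zr r1] r0; have M0 := coef_bounded_ge0 aM.
have [|B hB] := @sum_sqr_geometric_bounded _ rho; first by rewrite ltW.
have [d cd] : exists d : C, series (fun n => n.+1%:R * a n.+1 * z ^+ n) @ \oo --> d.
  apply: (@cvgC_series _ _ (M * B)) => n.
  apply: (le_trans _ (ler_wpM2l M0 (hB n))); rewrite mulr_sumr.
  apply: ler_sum => i _; rewrite !normcM normc_nat normcX.
  rewrite mulrAC mulrC; apply: ler_pM; rewrite ?mulr_ge0 ?exprn_ge0 ?normc_ge0//.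
  apply: ler_pM; rewrite ?exprn_ge0 ?normc_ge0 ?ler_eXnr ?ler1n//.
  by rewrite lerXn2r ?nnegrE ?normc_ge0// ltW.
exists d; split=> //; exists (M * B / rho) => h zhr.
have rho2 : 0 < rho ^+ 2 by exact: exprn_gt0.
(* The series of [f] are cut at [N + 1] and that of the derivative at [N], so that they match once
   the constant terms cancel. *)
apply: (@cvgC_normc_le _ _ \oo _ (fun N =>
   series (fun k => a k * (z + h) ^+ k) N.+1 - series (fun k => a k * z ^+ k) N.+1 -
   h * series (fun n => n.+1%:R * a n.+1 * z ^+ n) N : C)).
  apply: (@cvgB _ C); last by apply: (@cvgM C); [exact: cvg_cst|exact: cd].
  apply: (@cvgB _ C).
    have := fa (z + h); rewrite unit_discE => /(_ (le_lt_trans zhr r1)) c.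
    by rewrite -(cvg_shiftS (series _)) in c.
  have := fa z; rewrite unit_discE => /(_ (le_lt_trans zr r1)) c.
  by rewrite -(cvg_shiftS (series _)) in c.
near=> N; rewrite -(ler_pM2l rho2).
rewrite /series/= (big_nat_recl _ _ (fun k => a k * (z + h) ^+ k))//=.
rewrite (big_nat_recl _ _ (fun k => a k * z ^+ k))//= !expr0.
rewrite (_ : _ - _ - _ = \sum_(0 <= i < N)
    a i.+1 * ((z + h) ^+ i.+1 - z ^+ i.+1 - i.+1%:R * h * z ^+ i)); last first.
  rewrite mulr_sumr opprD addrACA subrr add0r -!sumrB.
  by apply: eq_bigr => i _; ring.
apply: (le_trans (ler_wpM2l (ltW rho2) (normc_sum _ _ _))).
rewrite mulr_sumr.
apply: (@le_trans _ _
  (M * normc h ^+ 2 * rho * \sum_(0 <= i < N) i.+1%:R ^+ 2 * rho ^+ i)).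
  rewrite mulr_sumr; apply: ler_sum => i _.
  rewrite normcM mulrCA; apply: (le_trans (ler_pM _ _ (aM i.+1) (exprD_taylor2_le i zr zhr))).
  - exact: normc_ge0.
  - by rewrite mulr_ge0 ?normc_ge0// ltW.
  - rewrite (exprS rho) le_eqVlt; apply/orP; left; apply/eqP; ring.
apply: (le_trans (ler_wpM2l _ (hB N))).
  by rewrite !mulr_ge0 ?exprn_ge0 ?normc_ge0 ?(ltW r0).
rewrite le_eqVlt; apply/orP; left; apply/eqP; field; exact: lt0r_neq0.
Unshelve. all: by end_near. Qed.

Lemma taylor_disc_derive M (f : C -> C) a z :
  coef_bounded M a -> taylor_disc f a -> unit_disc (z : C) ->
  derivable f z 1 /\
  series (fun n => n.+1%:R * a n.+1 * z ^+ n) @ \oo --> (f^`()%classic z : C).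
Proof.
move=> aM fa zD; rewrite unit_discE in zD.
pose rho : R := (1 + normc z) / 2.
have zr : normc z < rho by rewrite /rho; lra.
have r1 : rho < 1 by rewrite /rho; lra.
have r0 : 0 < rho by exact: le_lt_trans (normc_ge0 z) zr.
have zr1 : normc z <= rho < 1 by rewrite (ltW zr) r1.
have [d [cd [K hK]]] := taylor_disc_taylor1 aM fa zr1 r0.
(* The sign of [K] is read off by testing the estimate at the nonzero real increment [rho - |z|]. *)
have K0 : 0 <= K.
  have r1z : normc (z + (rho - normc z)%:C) <= rho.
    apply: (le_trans (normcD _ _)).
    by rewrite normc_real ger0_norm ?subr_ge0 ?(ltW zr)// addrC subrK.
  have := le_trans (normc_ge0 _) (hK _ r1z); rewrite pmulr_lge0//.
  by rewrite normc_real exprn_gt0// normr_gt0 subr_eq0 gt_eqF.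
have cf : (fun h : C => h^-1 *: (f (h + z) - f z)) @ 0^' --> d.
  apply/cvgC_norm; apply/cvgrPdist_lt => e e0.
  (* The first bound keeps [z + h] within radius [rho], the second makes [K |h| < e]; [K + 1] avoids
     a division by zero. *)
  pose del := Num.min (rho - normc z) (e / (K + 1)).
  have del0 : 0 < del.
    by rewrite lt_min subr_gt0 zr divr_gt0// ltr_wpDl.
  have del0' : 0 < del%:C :> C by rewrite -[0]/(0%:C) ltcR.
  near=> h.
  have hdel : normc h < del.
    suff : `|h| < del%:C by rewrite normr_normc ltcR.
    near: h; exists del%:C => //= h; rewrite /ball_/= sub0r normrN => hd _.
    exact: hd.
  have h0 : h != 0 by near: h; exact: nbhs_dnbhs_neq.
  have nh0 : 0 < normc h by rewrite lt_neqAle normc_ge0 eq_sym normc_eq0 h0.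
  move: hdel; rewrite lt_min => /andP[hd1 hd2].
  rewrite sub0r normrN ger0_norm ?normc_ge0// normcB.
  rewrite (_ : _ - d = h^-1 * (f (z + h) - f z - h * d)); last first.
    by rewrite /GRing.scale/= [h + z]addrC; field.
  rewrite normcM normcV -(ltr_pM2l nh0) mulVKf ?lt0r_neq0//.
  apply: (le_lt_trans (hK h _)).
    by apply: (le_trans (normcD _ _)); rewrite addrC -lerBrDr ltW.
  rewrite expr2 mulrCA ltr_pM2l//; apply: (@le_lt_trans _ _ ((K + 1) * normc h)).
    by rewrite ler_wpM2r ?normc_ge0// lerDl.
  by rewrite mulrC -ltr_pdivlMr// ltr_wpDl.
split; last by rewrite /derive1 (cvg_lim _ cf)//; exact: norm_hausdorff.
apply/cvg_ex; exists d.
rewrite (_ : (fun h => _) = (fun h : C => h^-1 *: (f (h + z) - f z)))//.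
by apply/funext => h /=; rewrite [h *: 1]mulr1.
Unshelve. all: by end_near. Qed.

End BoundedPowerSeries.

(** * Weighted sums, truncated matrix action and elementary inequalities *)

Section WeightedSums.
Context (R : realType).
Implicit Types (s alpha gamma : R) (a b x : nat -> R[i]) (t : nat -> nat -> R[i]).

Lemma dirichlet_weight_ge1 s n : s < 1 -> 1 <= dirichlet_weight s n.
Proof.
move=> s1; rewrite /dirichlet_weight -[leLHS](@powRr0 _ n.+1%:R).
by rewrite ler_powR ?ler1n// subr_ge0 ltW.
Qed.

Lemma dirichlet_weight_le s n : 0 < s -> dirichlet_weight s n <= n.+1%:R.
Proof.
by move=> s0; apply: ler1_powR; rewrite ?ler1n// gerBl ltW.
Qed.

Lemma dirichlet_weight_exchange alpha gamma n :
  dirichlet_weight gamma n =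
  dirichlet_weight alpha n * n.+1%:R `^ (alpha - gamma).
Proof.
rewrite /dirichlet_weight -powRD ?pnatr_eq0 ?implybT//.
by congr (_ `^ _); ring.
Qed.

(** The lower cutoff [L] lets the same estimates serve norms ([L = 0]) and tails ([L] large). *)
Definition weighted_sum s a (L K : nat) :=
  \sum_(L <= k < K) dirichlet_weight s k * normc (a k) ^+ 2.

Lemma weighted_sum_ge0 s a L K : 0 <= weighted_sum s a L K.
Proof. by apply: sumr_ge0 => k _; exact: dirichlet_term_ge0. Qed.

Lemma normc_le_weighted_sum s a n K : s < 1 -> (n < K)%N ->
  normc (a n) <= Num.sqrt (weighted_sum s a 0 K).
Proof.
move=> s1 nK; rewrite -[leLHS]ger0_norm ?normc_ge0// -sqrtr_sqr ler_wsqrtr//.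
rewrite /weighted_sum (big_cat_nat (n := n))//=; last exact: ltnW.
rewrite (big_ltn nK) addrCA.
apply: (@le_trans _ _ (dirichlet_weight s n * normc (a n) ^+ 2)).
  by rewrite ler_peMl ?sqr_ge0// dirichlet_weight_ge1.
by rewrite lerDl addr_ge0// weighted_sum_ge0.
Qed.

Lemma coef_bounded_weighted_sum s a (S : R) : s < 1 ->
  (forall K, weighted_sum s a 0 K <= S) -> coef_bounded (Num.sqrt S) a.
Proof.
move=> s1 aS n; apply: (le_trans (normc_le_weighted_sum a s1 (ltnSn n))).
exact: ler_wsqrtr.
Qed.

Definition mapply t (N : nat) x (k : nat) := \sum_(0 <= n < N) t k n * x n.

Lemma sqr_normcD_le (z w : R[i]) :
  normc (z + w) ^+ 2 <= 2 * normc z ^+ 2 + 2 * normc w ^+ 2.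
Proof.
apply: (@le_trans _ _ ((normc z + normc w) ^+ 2)).
  by rewrite lerXn2r ?nnegrE ?addr_ge0 ?normc_ge0// normcD.
rewrite -subr_ge0 (_ : _ - _ = (normc z - normc w) ^+ 2) ?sqr_ge0//; ring.
Qed.

Lemma weighted_sum_seqB_le s a b L K :
  weighted_sum s (fun n => a n - b n) L K <=
    2 * weighted_sum s a L K + 2 * weighted_sum s b L K.
Proof.
have E c : 2 * weighted_sum s c L K =
    \sum_(L <= k < K) 2 * (dirichlet_weight s k * normc (c k) ^+ 2).
  by rewrite /weighted_sum mulr_sumr.
rewrite !E -big_split; apply: ler_sum => k _.
have h := sqr_normcD_le (a k) (- b k); rewrite normcN in h.
have w0 : 0 <= dirichlet_weight s k by rewrite ltW// dirichlet_weight_gt0.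
apply: (le_trans (ler_wpM2l w0 h)).
by rewrite mulrDr !(mulrCA 2).
Qed.

Lemma sum_inv_sqr_le n : \sum_(0 <= k < n) (k.+1%:R ^- 2) <= 2 :> R.
Proof.
case: n => [|n]; first by rewrite big_geq.
(* The sharper bound makes the induction close: [1 / (n + 2)^2] is less than
   [1 / (n + 1) - 1 / (n + 2)]. *)
suff : \sum_(0 <= k < n.+1) (k.+1%:R ^- 2) <= 2 - n.+1%:R^-1 :> R.
  by move/le_trans; apply; rewrite gerBl invr_ge0.
elim: n => [|n IH]; first by rewrite big_nat1 expr1n invr1; lra.
rewrite big_nat_recr//=; apply: (le_trans (lerD IH (lexx _))).
rewrite -subr_ge0 (_ : _ - _ = (n.+1%:R * n.+2%:R ^+ 2)^-1).
  by rewrite invr_ge0 mulr_ge0// exprn_ge0.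
have n1 : n.+1%:R != 0 :> R by rewrite pnatr_eq0.
have n2 : n.+1%:R + 1 != 0 :> R by rewrite natr1 pnatr_eq0.
rewrite -(natr1 n.+1); move: (n.+1%:R : R) n1 n2 => u u0 u1; field.
by rewrite u1 u0.
Qed.

(** Cauchy-Schwarz against the constant sequence, obtained by summing [(u i - u j) ^+ 2 >= 0] over
    all pairs. *)
Lemma sqr_sum_le (n : nat) (u : nat -> R) :
  (\sum_(0 <= k < n) u k) ^+ 2 <= n%:R * \sum_(0 <= k < n) u k ^+ 2.
Proof.
set S := \sum_(0 <= k < n) u k ^+ 2.
have SE : \sum_(0 <= i < n) \sum_(0 <= j < n) (u i ^+ 2 + u j ^+ 2) =
    2 * (n%:R * S).
  rewrite (eq_bigr (fun i => n%:R * u i ^+ 2 + S)); last first.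
    by move=> i _; rewrite big_split/= sumr_const_nat subn0 mulr_natl.
  rewrite big_split/= sumr_const_nat subn0 -mulr_sumr -/S.
  by rewrite -[S *+ n]mulr_natl; ring.
rewrite -(@ler_pM2l _ 2)// -SE expr2 mulr_suml mulr_sumr.
apply: ler_sum => i _; rewrite !mulr_sumr; apply: ler_sum => j _.
rewrite -subr_ge0 (_ : _ - _ = (u i - u j) ^+ 2); last by ring.
exact: sqr_ge0.
Qed.

(** With [j] the logarithm, [2^j <= n + 1 < 2^(j + 1)], and a negative exponent reverses both
    inequalities. *)
Lemma powR_trunc_log (q s : R) n : s < 0 -> q = 2 `^ s ->
  n.+1%:R `^ s <= q ^+ trunc_log 2 n.+1 /\
  q ^+ (trunc_log 2 n.+1).+1 <= n.+1%:R `^ s.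
Proof.
move=> s0 ->.
have E j : (2 `^ s) ^+ j = (2 ^ j)%N%:R `^ s.
  by rewrite natrX -!powR_mulrn ?powR_ge0// powRAC.
have mono (i j : nat) : (0 < i)%N -> (i <= j)%N -> j%:R `^ s <= i%:R `^ s.
  move=> i0 ij; rewrite -[s]opprK !(powRN _ (- s)) lef_pV2 ?posrE ?powR_gt0 ?ltr0n//.
    by rewrite ge0_ler_powR ?nnegrE ?ler0n ?ler_nat// oppr_ge0 ltW.
  exact: leq_trans ij.
rewrite !E; split; apply: mono; rewrite ?expn_gt0//; first exact: trunc_logP.
by apply: ltnW; apply: trunc_log_ltn.
Qed.

(** The inputs that remain satisfy [k + 1 <= 2 l <= 2 (n + 1)], so the decay applies. Of the four
    factors [1 / (n + 1)], two give [4 / (k + 1)^2] and two are summed to at most 2, whence the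
    constant 8. *)
Lemma mapply_high_le t (D S : R) N x k l :
  (forall k n, (k.+1 <= 2 * n.+1)%N -> normc (t k n) <= D / n.+1%:R ^+ 4) ->
  0 <= D -> 0 <= S -> (forall n, (n < N)%N -> normc (x n) <= S) ->
  (k.+1 <= 2 * l)%N ->
  normc (\sum_(0 <= n < N) t k n * (if (n.+1 < l)%N then 0 else x n)) <=
    8 * D * S / k.+1%:R ^+ 2.
Proof.
move=> tD D0 S0 xS kl; apply: (le_trans (normc_sum _ _ _)).
apply: (@le_trans _ _ (\sum_(0 <= n < N) 4 * D * S / k.+1%:R ^+ 2 * n.+1%:R ^- 2)).
  rewrite big_nat [leRHS]big_nat; apply: ler_sum => n /andP[_ nN].
  have c0 : 0 <= 4 * D * S / k.+1%:R ^+ 2 * n.+1%:R ^- 2.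
    by rewrite !mulr_ge0 ?invr_ge0 ?exprn_ge0.
  case: ltnP => ln; first by rewrite mulr0 normc0.
  have kn : (k.+1 <= 2 * n.+1)%N by apply: (leq_trans kl); rewrite leq_mul2l.
  rewrite normcM (_ : 4 * D * S / _ / _ = (4 * D / k.+1%:R ^+ 2 / n.+1%:R ^+ 2) * S).
    apply: ler_pM; rewrite ?normc_ge0 ?xS//; apply: (le_trans (tD _ _ kn)).
    rewrite (_ : D / _ = D / n.+1%:R ^+ 2 / n.+1%:R ^+ 2); last first.
      by rewrite (exprD _ 2 2) invfM mulrA.
    rewrite ler_wpM2r ?invr_ge0 ?exprn_ge0// ler_pdivrMr ?exprn_gt0//.
    rewrite [leRHS]mulrAC ler_pdivlMr ?exprn_gt0// [leRHS]mulrAC mulrC.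
    rewrite ler_wpM2r//.
    rewrite (_ : 4 * _ = (2 * n.+1%:R) ^+ 2); last by ring.
    by rewrite lerXn2r ?nnegrE ?mulr_ge0// -natrM ler_nat.
  by field; rewrite !nat1r !pnatr_eq0.
rewrite -mulr_sumr; apply: (le_trans (ler_wpM2l _ (sum_inv_sqr_le N))).
  by rewrite !mulr_ge0 ?invr_ge0 ?exprn_ge0.
by rewrite le_eqVlt; apply/orP; left; apply/eqP; ring.
Qed.

End WeightedSums.

(** * Dyadic comparison of the two weights *)

Section Interpolation.
Context (R : realType).
Implicit Types (s alpha gamma D E : R) (x : nat -> R[i]) (t : nat -> nat -> R[i]).

Lemma geometric_tail_le (q : R) (l K : nat) : 0 <= q < 1 ->
  \sum_(0 <= j < K) (if (l < j)%N then q ^+ j else 0) <= q ^+ l.+1 / (1 - q).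
Proof.
move=> /andP[q0 q1]; have q10 : 0 < 1 - q by rewrite subr_gt0.
rewrite ler_pdivlMr//.
suff -> : (\sum_(0 <= j < K) (if (l < j)%N then q ^+ j else 0)) * (1 - q) =
    if (l < K)%N then q ^+ l.+1 - q ^+ K else 0.
  by case: ifP => _; rewrite ?exprn_ge0// gerBl exprn_ge0.
elim: K => [|K IH]; first by rewrite big_geq// mul0r.
rewrite big_nat_recr//= mulrDl IH.
case: (ltngtP l K) => [lK|lK|->].
- by rewrite (ltnW lK : l < K.+1)%N (exprSr q K); ring.
- by rewrite ltnS leqNgt lK/= mul0r addr0.
- by rewrite ltnSn mul0r addr0 subrr.
Qed.

(* Each output coordinate k is compared with the inputs below and above the
   dyadic scale 2 ^ j <= k + 1 < 2 ^ (j + 1): the lower part is controlled by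
   the alpha-bound on the truncation to n + 1 < 2 ^ j, gaining a factor
   2 ^ (j (alpha - gamma)), the upper part by the decay of the entries. *)
Lemma weighted_sum_interpolation alpha gamma t D :
  0 < alpha -> alpha < gamma < 1 ->
  (forall k n, (k.+1 <= 2 * n.+1)%N -> normc (t k n) <= D / n.+1%:R ^+ 4) ->
  exists2 c, 0 <= c & forall L E, 0 <= E ->
    (forall N x K, weighted_sum alpha (mapply t N x) L K <=
       E * weighted_sum alpha x 0 N) ->
    forall N x K, weighted_sum gamma (mapply t N x) L K <=
      c * (E + L.+1%:R^-1) * weighted_sum gamma x 0 N.
Proof.
move=> a0 /andP[ag g1] tD.
have D0 : 0 <= D.
  have := le_trans (normc_ge0 _) (tD 0%N 0%N isT).
  by rewrite expr1n divr1.
have g0 : 0 < gamma by exact: lt_trans ag.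
set s := alpha - gamma; have s0 : s < 0 by rewrite subr_lt0.
pose q : R := 2 `^ s.
have q0 : 0 <= q by exact: powR_ge0.
have q1 : q < 1.
  rewrite /q -[s]opprK powRN invf_lt1 ?powR_gt0//.
  rewrite -[ltLHS](@powRr0 _ 2) lt_neqAle; apply/andP; split; last first.
    by rewrite ler_powR ?ler1n// oppr_ge0 ltW.
  rewrite powRr0 eq_sym powR_eq1; lra.
have q01 : 0 <= q < 1 by rewrite q0.
have q10 : 0 < 1 - q by rewrite subr_gt0.
(* Squaring a sum of two parts doubles each: [1 / (1 - q)] comes from the low part, [128 * D ^+ 2]
   from the high part. *)
exists (2 / (1 - q) + 256 * D ^+ 2).
  by rewrite addr_ge0 ?divr_ge0 ?(ltW q10)// mulr_ge0 ?sqr_ge0.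
move=> L E E0 tE N x K.
set S := weighted_sum gamma x 0 N.
have S0 : 0 <= S by exact: weighted_sum_ge0.
have xS n : (n < N)%N -> normc (x n) <= Num.sqrt S.
  exact: normc_le_weighted_sum.
pose lev k := trunc_log 2 k.+1.
pose b j n : R[i] := if (n.+1 < 2 ^ j)%N then x n else 0.
pose high k : R[i] := \sum_(0 <= n < N) t k n * (if (n.+1 < 2 ^ lev k)%N then 0 else x n).
have splitE k : mapply t N x k = mapply t N (b (lev k)) k + high k.
  rewrite /mapply /high -big_split/=; apply: eq_bigr => n _.
  by rewrite /b; case: ifP => _; rewrite mulr0 ?addr0 ?add0r.
have hhigh k : normc (high k) ^+ 2 <= 64 * D ^+ 2 * S / k.+1%:R ^+ 4.
  have kl : (k.+1 <= 2 * 2 ^ lev k)%N by rewrite -expnS ltnW// trunc_log_ltn.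
  have := mapply_high_le tD D0 (sqrtr_ge0 S) xS kl.
  rewrite -/(high k) => h.
  rewrite (_ : 64 * _ * _ / _ = (8 * D * Num.sqrt S / k.+1%:R ^+ 2) ^+ 2).
    by rewrite lerXn2r ?nnegrE ?normc_ge0// ?divr_ge0 ?mulr_ge0 ?sqrtr_ge0 ?exprn_ge0.
  by rewrite -[in LHS](sqr_sqrtr S0) !exprMn exprVn -exprM; ring.
(* The truncation [b (lev k)] depends on [k]. Its term is majorized by the sum over all levels [j],
   so that the bound for [alpha] applies to each fixed [b j] with [k] running over the whole
   range. *)
have hlow k : (k < K)%N ->
    dirichlet_weight gamma k * normc (mapply t N (b (lev k)) k) ^+ 2 <=
    \sum_(0 <= j < K) q ^+ j * (dirichlet_weight alpha k * normc (mapply t N (b j) k) ^+ 2).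
  move=> kK; have lK : (lev k < K)%N.
    apply: leq_ltn_trans kK; rewrite -ltnS; apply: leq_trans (ltn_expl _ (ltnSn 1)) _.
    exact: trunc_logP.
  have [q_lev _] := @powR_trunc_log R q s k s0 erefl.
  rewrite (dirichlet_weight_exchange alpha).
  apply: (@le_trans _ _ (q ^+ lev k *
      (dirichlet_weight alpha k * normc (mapply t N (b (lev k)) k) ^+ 2))).
    by rewrite mulrAC mulrC ler_wpM2r// dirichlet_term_ge0.
  rewrite (big_cat_nat (n := lev k))//=; last exact: ltnW.
  rewrite (big_ltn lK) addrCA lerDl addr_ge0// sumr_ge0// => j _.
    by rewrite mulr_ge0 ?exprn_ge0// dirichlet_term_ge0.
  by rewrite mulr_ge0 ?exprn_ge0// dirichlet_term_ge0.
have low_le : \sum_(L <= k < K) dirichlet_weight gamma k *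
    normc (mapply t N (b (lev k)) k) ^+ 2 <= E / (1 - q) * S.
  apply: (@le_trans _ _ (\sum_(L <= k < K) \sum_(0 <= j < K)
    q ^+ j * (dirichlet_weight alpha k * normc (mapply t N (b j) k) ^+ 2))).
    by rewrite big_nat [leRHS]big_nat; apply: ler_sum => k /andP[_ kK]; exact: hlow.
  rewrite exchange_big/=.
  apply: (@le_trans _ _ (\sum_(0 <= j < K) q ^+ j * (E * weighted_sum alpha (b j) 0 N))).
    by apply: ler_sum => j _; rewrite -mulr_sumr ler_wpM2l ?exprn_ge0//; exact: tE.
  rewrite (eq_bigr (fun j => E * \sum_(0 <= n < N)
     dirichlet_weight alpha n * normc (x n) ^+ 2 *
     (if (n.+1 < 2 ^ j)%N then q ^+ j else 0))); last first.
    move=> j _; rewrite mulrCA; congr (_ * _); rewrite mulr_sumr; apply: eq_bigr => n _.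
    by rewrite /b; case: ifP => _; rewrite ?normc0 ?expr0n/= ?mulr0// mulrC.
  rewrite -mulr_sumr exchange_big/= -mulrA ler_wpM2l// mulrC ler_pdivlMr//.
  rewrite mulr_suml; apply: ler_sum => n _.
  rewrite -mulr_sumr (dirichlet_weight_exchange alpha gamma) -/s -[leRHS]mulrA -2![leLHS]mulrA.
  rewrite ler_wpM2l ?(ltW (dirichlet_weight_gt0 _ _))// [leRHS]mulrC ler_wpM2l ?sqr_ge0//.
  have [_ q_lev] := @powR_trunc_log R q s n s0 erefl.
  apply: le_trans q_lev; rewrite -ler_pdivlMr//.
  (* An input [n] occurs only at levels [j > lev n]; their geometric tail is at most
     [(n + 1)^(alpha - gamma) / (1 - q)], and this power of [n + 1] is the ratio of the two
     weights. *)
  apply: le_trans (geometric_tail_le _ K q01); apply: ler_sum => j _.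
  case: ifP => nj; case: ifP => lj//; rewrite ?exprn_ge0//.
  move: lj; rewrite ltnNge => /negbFE lj.
  by have := leq_trans nj (leq_pexp2l (isT : 0 < 2)%N lj); rewrite ltnNge trunc_logP.
have high_le : \sum_(L <= k < K) dirichlet_weight gamma k * normc (high k) ^+ 2 <=
    128 * D ^+ 2 / L.+1%:R * S.
  apply: (@le_trans _ _ (\sum_(L <= k < K) 64 * D ^+ 2 * S / L.+1%:R * k.+1%:R ^- 2)).
    rewrite big_nat [leRHS]big_nat; apply: ler_sum => k /andP[Lk _].
    (* The weight is at most [k + 1], which leaves [(k + 1)^(-3)]: one factor gives [1 / (L + 1)]
       because [k >= L], the other two are summable. *)
    apply: (@le_trans _ _ (k.+1%:R * (64 * D ^+ 2 * S / k.+1%:R ^+ 4))).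
      by apply: ler_pM; rewrite ?sqr_ge0 ?dirichlet_weight_le// ltW// dirichlet_weight_gt0.
    rewrite (_ : k.+1%:R * _ = 64 * D ^+ 2 * S / k.+1%:R * k.+1%:R ^- 2); last first.
      by field; rewrite nat1r pnatr_eq0.
    rewrite ler_wpM2r ?invr_ge0 ?exprn_ge0// ler_wpM2l ?mulr_ge0 ?sqr_ge0//.
    by rewrite lef_pV2 ?posrE// ler_nat.
  rewrite -mulr_sumr (_ : 128 * _ / _ * S = 64 * D ^+ 2 * S / L.+1%:R * 2); last by ring.
  rewrite ler_wpM2l//; first by rewrite divr_ge0// mulr_ge0// mulr_ge0// sqr_ge0.
  apply: le_trans (sum_inv_sqr_le R K).
  have [LK|KL] := leqP L K; last first.
    rewrite big_geq ?(ltnW KL)//; apply: sumr_ge0 => i _.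
    by rewrite invr_ge0 exprn_ge0.
  rewrite [leRHS](big_cat_nat (n := L))//= lerDr; apply: sumr_ge0 => i _.
  by rewrite invr_ge0 exprn_ge0.
apply: (@le_trans _ _ (2 * (E / (1 - q) * S) + 2 * (128 * D ^+ 2 / L.+1%:R * S))).
  apply: (@le_trans _ _ (\sum_(L <= k < K) (
    2 * (dirichlet_weight gamma k * normc (mapply t N (b (lev k)) k) ^+ 2) +
    2 * (dirichlet_weight gamma k * normc (high k) ^+ 2)))).
    apply: ler_sum => k _; rewrite splitE ![2 * (dirichlet_weight _ _ * _)]mulrCA -mulrDr.
    by rewrite ler_wpM2l ?sqr_normcD_le// ltW// dirichlet_weight_gt0.
  by rewrite big_split/= -!mulr_sumr lerD// ler_wpM2l.
have Li : 0 <= L.+1%:R^-1 :> R by rewrite invr_ge0.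
rewrite !mulrA -mulrDl ler_wpM2r// -subr_ge0.
rewrite (_ : _ - _ = 2 / (1 - q) * L.+1%:R^-1 + 256 * D ^+ 2 * E); last by ring.
by rewrite addr_ge0// mulr_ge0 ?mulr_ge0 ?sqr_ge0 ?invr_ge0 ?(ltW q10).
Qed.

End Interpolation.

(** * Decay of the coefficients of high powers *)

Section PowerDecay.
Context (R : realType).
Implicit Types (a b : nat -> R[i]) (p : nat -> nat -> R[i]).

Definition abs_sum a (K : nat) : R := \sum_(0 <= k < K) normc (a k).

Lemma abs_sum_ge0 a K : 0 <= abs_sum a K.
Proof. by apply: sumr_ge0 => k _; exact: normc_ge0. Qed.

(** For the moduli, at [z = 1], the triangle [i + j < K] is contained in the square [i, j < K]. *)
Lemma abs_sum_cauchy_prod a b K :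
  abs_sum (cauchy_prod a b) K <= abs_sum a K * abs_sum b K.
Proof.
apply: (@le_trans _ _ (\sum_(0 <= k < K)
    cauchy_prod (fun i => normc (a i)) (fun i => normc (b i)) k * 1 ^+ k)).
  apply: ler_sum => k _; rewrite expr1n mulr1; apply: (le_trans (normc_sum _ _ _)).
  by apply: ler_sum => i _; rewrite normcM.
rewrite sum_cauchy_prod /abs_sum mulr_suml; apply: ler_sum => i _.
rewrite expr1n mulr1 ler_wpM2l ?normc_ge0//.
under eq_bigr do rewrite expr1n mulr1.
rewrite [leRHS](big_cat_nat (n := K - i))//= ?leq_subr// lerDl.
by apply: sumr_ge0 => j _; exact: normc_ge0.
Qed.

(** The exponent splits into [q] copies of [N] and one [N + r], all at least [N]. *)
Lemma abs_sum_power_le p (K N r q : nat) (B : R) : 0 <= B ->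
  (forall m n, p (m + n)%N = cauchy_prod (p m) (p n)) ->
  (forall m, (N <= m)%N -> abs_sum (p m) K <= B) ->
  abs_sum (p (N * q.+1 + r)%N) K <= B ^+ q.+1.
Proof.
move=> B0 pD pB; elim: q => [|q IH].
  by rewrite expr1 muln1; apply: pB; exact: leq_addr.
rewrite mulnSr addnAC addnC pD exprS; apply: (le_trans (abs_sum_cauchy_prod _ _ _)).
by apply: ler_pM; rewrite ?abs_sum_ge0// pB.
Qed.

(* By Cauchy-Schwarz the K-th partial absolute sum of p m is at most
   (M K) ^ (1/2) (m + 1) ^ (- (1 + alpha) / 2); for K of the order of m this is a
   small negative power of m, which submultiplicativity turns into any power. *)
Lemma power_coef_decay p (alpha M : R) : 0 < alpha < 1 -> 0 <= M ->
  (forall m n, p (m + n)%N = cauchy_prod (p m) (p n)) ->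
  (forall m K, \sum_(0 <= k < K) normc (p m k) ^+ 2 <= M * m.+1%:R `^ (- (1 + alpha))) ->
  exists2 D : R, 0 <= D & forall k n, (k < 4 * n.+1)%N ->
    normc (p n k) <= D / n.+1%:R ^+ 5.
Proof.
move=> /andP[a0 a1] M0 pD pM.
(* Chosen so that [(n + 1)^(- alpha (Q + 1))], which appears under a square root, is at most
   [(n + 1)^(-10)]. *)
pose Q := (Num.bound (10 / alpha)).
have Qa : 10 <= alpha * Q.+1%:R.
  rewrite mulrC -ler_pdivrMr//; apply/ltW.
  have h : 10 / alpha < Q%:R.
    by apply: archi_boundP; rewrite divr_ge0 ?(ltW a0).
  by apply: (lt_le_trans h); rewrite ler_nat.
(* The factor 4 comes from [K = 4 (n + 1)], the factor [(Q + 1)^2] from replacing [m + 1] by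
   [n + 1]. *)
pose M' := 4 * M * Q.+1%:R ^+ 2.
have M'0 : 0 <= M' by rewrite !mulr_ge0// exprn_ge0.
exists (Num.sqrt (M' ^+ Q.+1)); first exact: sqrtr_ge0.
(* With this [N], the exponent [n] splits into [Q + 1] exponents that are at least [N], and [m >= N]
   forces [n + 1 <= (Q + 1) (m + 1)]. *)
move=> k n kn; pose N := (n %/ Q.+1)%N; pose K := (4 * n.+1)%N.
have nN : n = (N * Q.+1 + n %% Q.+1)%N by exact: divn_eq.
pose c := M' * n.+1%:R `^ (- alpha).
have c0 : 0 <= c by rewrite mulr_ge0 ?powR_ge0.
have pN m : (N <= m)%N -> abs_sum (p m) K <= Num.sqrt c.
  move=> Nm; rewrite -[leLHS]ger0_norm ?abs_sum_ge0// -sqrtr_sqr ler_wsqrtr//.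
  apply: (le_trans (sqr_sum_le _ _)).
  apply: (le_trans (ler_wpM2l (ler0n _ _) (pM _ _))).
  have nm : n.+1%:R <= Q.+1%:R * m.+1%:R :> R.
    rewrite -natrM ler_nat mulnC; apply: leq_trans (ltn_ceil n (ltn0Sn Q)) _.
    by rewrite leq_mul2r ltnS Nm orbT.
  have mP : m.+1%:R `^ (- (1 + alpha)) <= Q.+1%:R ^+ 2 * n.+1%:R `^ (- (1 + alpha)).
    rewrite !powRN -(ler_pM2r (x := n.+1%:R `^ (1 + alpha))) ?powR_gt0//.
    rewrite -mulrA mulVf ?mulr1 ?gt_eqF ?powR_gt0//.
    rewrite mulrC ler_pdivrMr ?powR_gt0//.
    apply: (@le_trans _ _ ((Q.+1%:R * m.+1%:R) `^ (1 + alpha))).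
      apply: ge0_ler_powR => //; rewrite ?nnegrE ?mulr_ge0//.
      by rewrite addr_ge0// ltW.
    rewrite powRM// ler_wpM2r ?powR_ge0// -powR_mulrn//.
    by rewrite ler_powR ?ler1n//; lra.
  apply: (@le_trans _ _ (K%:R * (M * (Q.+1%:R ^+ 2 * n.+1%:R `^ (- (1 + alpha)))))).
    by rewrite ler_wpM2l// ler_wpM2l.
  rewrite /c /M' /K natrM le_eqVlt; apply/orP; left; apply/eqP.
  rewrite opprD powRD ?pnatr_eq0 ?implybT// powR_inv1//.
  by field; rewrite nat1r pnatr_eq0.
have := abs_sum_power_le (n %% Q.+1) Q (sqrtr_ge0 c) pD pN; rewrite -nN => h.
apply: (@le_trans _ _ (abs_sum (p n) K)).
  rewrite /abs_sum (big_cat_nat (n := k))//= ?(ltnW kn)// (big_ltn kn) addrCA.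
  by rewrite lerDl addr_ge0// sumr_ge0// => i _; exact: normc_ge0.
apply: (le_trans h).
have -> : n.+1%:R ^+ 5 = Num.sqrt (n.+1%:R ^+ 10) :> R.
  by rewrite (exprM _ 5 2) sqrtr_sqr ger0_norm// exprn_ge0.
rewrite -sqrtrV ?exprn_ge0// -sqrtrM ?exprn_ge0//.
have -> : Num.sqrt c ^+ Q.+1 = Num.sqrt (c ^+ Q.+1).
  rewrite -[LHS]ger0_norm ?exprn_ge0 ?sqrtr_ge0// -sqrtr_sqr exprAC sqr_sqrtr//.
rewrite ler_wsqrtr// /c exprMn ler_wpM2l ?exprn_ge0//.
rewrite -powR_mulrn ?powR_ge0// -powRrM -(powR_invn 10)//.
by rewrite ler_powR ?ler1n// mulNr lerN2.
Qed.

End PowerDecay.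

(** * Elements of the weighted Dirichlet space and their coefficients *)

Section DirichletElements.
Context (R : realType) (s : R) (s1 : s < 1).
Local Notation C := (R[i] : numFieldType).
Implicit Types (f g : dirichlet s) (a : nat -> R[i]).

Lemma dirichlet_norm_sqr f :
  `|f| ^+ 2 = limn (dirichlet_series s (taylor f)).
Proof.
rewrite [`|f|]/(dirichlet_norm f) /dirichlet_norm /dirichlet_seqnorm sqr_sqrtr//.
apply: limr_ge; first exact: cvg_dirichlet.
by near=> n; exact: dirichlet_series_ge0.
Unshelve. all: by end_near. Qed.

Lemma weighted_sum_dirichlet_le f L K :
  weighted_sum s (taylor f) L K <= `|f| ^+ 2.
Proof.
apply: (@le_trans _ _ (dirichlet_series s (taylor f) K)); last first.
  rewrite dirichlet_norm_sqr; apply: nondecreasing_cvgn_le.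
    exact: nondecreasing_dirichlet_series.
  exact: cvg_dirichlet.
have [LK|KL] := leqP L K; last first.
  by rewrite /weighted_sum big_geq ?(ltnW KL)// dirichlet_series_ge0.
rewrite [leRHS](big_cat_nat (n := L))//= lerDr.
exact: weighted_sum_ge0.
Qed.

Lemma coef_bounded_dirichlet f : coef_bounded `|f| (taylor f).
Proof.
move=> n; rewrite -(@ler_pXn2r _ 2)// ?nnegrE ?normc_ge0//.
apply: le_trans (weighted_sum_dirichlet_le f n n.+1).
rewrite /weighted_sum big_nat1 ler_peMl ?sqr_ge0//.
exact: dirichlet_weight_ge1.
Qed.

Lemma dirichlet_norm_sqr_le f (S : R) :
  (forall K, weighted_sum s (taylor f) 0 K <= S) -> `|f| ^+ 2 <= S.
Proof.
move=> fS; rewrite dirichlet_norm_sqr; apply: limr_le; first exact: cvg_dirichlet.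
by near=> n; exact: fS.
Unshelve. all: by end_near. Qed.

Lemma dirichlet_ext f g : (forall z : C, unit_disc z -> f z = g z) -> f = g.
Proof.
move=> fg; apply/val_inj/funext => z /=.
have [zD|zD] := pselect (unit_disc (z : C)); first exact: fg.
have [_ f0 _] := dirichletP f; have [_ g0 _] := dirichletP g.
by rewrite (f0 z zD) (g0 z zD).
Qed.

(** The weights are at least 1, so the coefficients are bounded and termwise differentiation gives
    holomorphy. *)
Lemma dirichlet_of_taylor (h : C -> C) a (S : R) :
  taylor_disc h a -> (forall K, weighted_sum s a 0 K <= S) ->
  exists f : dirichlet s,
    [/\ forall z : C, unit_disc z -> f z = h z, taylor f = a & `|f| ^+ 2 <= S].
Proof.
move=> ha aS.
have aB := coef_bounded_weighted_sum s1 aS.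
(* Elements of [dirichlet s] vanish off the disc, hence the extension by 0. *)
pose h0 : C -> C := fun z => if `[< unit_disc z >] then h z else 0.
have h0E z : unit_disc z -> h0 z = h z.
  by move=> zD; rewrite /h0; case: asboolP.
have h0a : taylor_disc h0 a by move=> z zD; rewrite h0E//; exact: ha.
have ca : cvgn (dirichlet_series s a).
  apply: nondecreasing_is_cvgn; first exact: nondecreasing_dirichlet_series.
  by exists S => _ [n _ <-]; exact: aS.
have h0P : (h0 : R[i] -> R[i]^o) \in dirichlet_pred s.
  apply/mem_set; split.
  - move=> z zD; have [dz _] := taylor_disc_derive aB h0a zD; exact dz.
  - by move=> z zD; rewrite /h0; case: asboolP.
  - by exists a => //; exact h0a.
exists (Dirichlet h0P).
have ta : taylor (Dirichlet h0P) = a.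
  by apply: (@taylorE _ _ (Dirichlet h0P)); exact h0a.
split=> //.
by apply: dirichlet_norm_sqr_le => K; rewrite ta.
Qed.

Lemma dirichlet_poly (N : nat) a : exists f : dirichlet s,
  [/\ forall z : C, unit_disc z -> f z = \sum_(0 <= n < N) a n * z ^+ n,
      taylor f = (fun n => if (n < N)%N then a n else 0) &
      `|f| ^+ 2 <= weighted_sum s a 0 N].
Proof.
apply: dirichlet_of_taylor => [z zD|K].
  apply: (@cvg_near_cst _ _ (\sum_(0 <= n < N) a n * z ^+ n : C) _ \oo).
  near=> m; have Nm : (N <= m)%N by near: m; exact: nbhs_infty_ge.
  rewrite /series/= (@big_cat_nat _ _ _ N)//= [X in _ + X]big1_seq ?addr0; last first.
    by move=> i; rewrite mem_index_iota => /andP[_ /andP[Ni _]]; rewrite ltnNge Ni mul0r.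
  by rewrite big_nat [RHS]big_nat; apply: eq_bigr => i /andP[_ ->].
apply: (@le_trans _ _ (weighted_sum s (fun n => if (n < N)%N then a n else 0) 0 (maxn N K))).
  rewrite [leRHS](big_cat_nat (n := K))//= ?leq_maxr// lerDl.
  exact: weighted_sum_ge0.
rewrite [leLHS](big_cat_nat (n := N))//= ?leq_maxl// [X in _ + X]big1_seq ?addr0.
  by rewrite le_eqVlt; apply/orP; left; apply/eqP; rewrite big_nat [RHS]big_nat;
    apply: eq_bigr => i /andP[_ ->].
move=> i; rewrite mem_index_iota => /andP[_ /andP[Ni _]].
rewrite ifF; last by rewrite ltnNge Ni.
by rewrite normc0 expr0n mulr0.
Unshelve. all: by end_near. Qed.

Lemma taylor_linear (k : R[i]) f g :
  taylor (k *: f + g) = (fun n => k * taylor f n + taylor g n).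
Proof.
apply: (@taylorE _ _ (k *: f + g)).
exact (taylor_discD (@taylor_discZ _ k _ _ (@taylorP _ _ f)) (@taylorP _ _ g)).
Qed.

Lemma taylor_sum (N : nat) (x : nat -> R[i]) (e : nat -> dirichlet s) k :
  taylor (\sum_(0 <= n < N) x n *: e n) k = \sum_(0 <= n < N) x n * taylor (e n) k.
Proof.
elim: N => [|N IH].
  rewrite !big_geq//; have -> // : taylor (0 : dirichlet s) = (fun=> 0).
  by apply: (@taylorE _ _ 0); exact: taylor_disc0.
by rewrite big_nat_recr//= [X in taylor X]addrC taylor_linear IH addrC [RHS]big_nat_recr.
Qed.

Lemma dirichlet_derive f (w : C) : unit_disc w ->
  derivable (f : C -> C) w 1 /\
  series (fun n => n.+1%:R * taylor f n.+1 * w ^+ n) @ \oo -->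
    ((f : C -> C)^`()%classic w : C).
Proof.
by move=> wD; have := taylor_disc_derive (@coef_bounded_dirichlet f) (@taylorP _ _ f) wD.
Qed.

End DirichletElements.

(** * The matrix of the composition-differentiation operator *)

Lemma cvgC_unique (R : realType) (T : Type) (F : set_system T)
    {FF : ProperFilter F} (u : T -> (R[i] : numFieldType))
    (l l' : (R[i] : numFieldType)) :
  u @ F --> l -> u @ F --> l' -> l = l'.
Proof. by move=> ul ul'; exact: cvg_unique ul ul'. Qed.

Section CompDiffMatrix.
Context (R : realType).
Local Notation C := (R[i] : numFieldType).
Implicit Types (alpha gamma s : R) (phi : R[i] -> R[i]) (t : nat -> nat -> R[i])
  (x a : nat -> R[i]).

(** A finite weighted sum is continuous in its coefficients. The filter is arbitrary because both
    sequences and ultrafilters occur below. *)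
Lemma cvgC_weighted_sum_le s (T : Type) (F : set_system T)
    {FF : ProperFilter F} (a_ : T -> nat -> R[i]) a L K (S : R) :
  (forall k, a_ ^~ k @ F --> (a k : C)) ->
  (\forall N \near F, weighted_sum s (a_ N) L K <= S) ->
  weighted_sum s a L K <= S.
Proof.
move=> aa aS.
have nc k : (fun N => normc (a_ N k)) @ F --> normc (a k).
  apply/cvgrPdist_lt => e e0.
  have /cvgC_norm/cvgrPdist_lt/(_ _ e0) := aa k.
  apply: filterS => N; rewrite sub0r normrN ger0_norm ?normc_ge0//.
  apply: le_lt_trans.
  have h1 : normc (a_ N k) <= normc (a k) + normc (a k - a_ N k).
    by rewrite normcB; apply: le_trans (normcD _ _); rewrite addrC subrK.
  have h2 : normc (a k) <= normc (a_ N k) + normc (a k - a_ N k).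
    by apply: le_trans (normcD _ _); rewrite addrC subrK.
  by rewrite ler_norml; apply/andP; split; lra.
have sc : (fun N => weighted_sum s (a_ N) L K) @ F --> weighted_sum s a L K.
  apply: cvg_big => [|k _]; first exact: add_continuous.
  by apply: cvgM; [exact: cvg_cst|apply: cvgM; exact: nc].
by rewrite -(cvg_lim _ sc)//; apply: limr_le => //; apply/cvg_ex; eexists; exact: sc.
Qed.

Lemma taylor_inj s (s1 : s < 1) : injective (fun f : dirichlet s => taylor f).
Proof.
move=> f g fg; apply: dirichlet_ext => z zD.
have fz := @taylorP _ _ f z zD; have gz := @taylorP _ _ g z zD.
rewrite fg in fz; exact: (cvgC_unique fz gz).
Qed.

(** Column [n] represents the image of [z^n], which is independent of the weight, so one matrix
    serves both spaces. For [n = 0] the factor [n%:R] makes the column vanish whatever [n.-1] is. *)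
Definition comp_diff_matrix phi t :=
  forall n, taylor_disc (fun z : C => n%:R * phi z ^+ n.-1 : C) (t ^~ n).

Definition unit_seq n : nat -> R[i] := fun m => (m == n)%:R.

Lemma dirichlet_monomial s n : s < 1 -> exists e : dirichlet s,
  taylor e = unit_seq n /\
  forall w : C, unit_disc w -> (e : C -> C)^`()%classic w = n%:R * w ^+ n.-1.
Proof.
move=> s1; have [e [_ te _]] := dirichlet_poly s1 n.+1 (unit_seq n).
have {}te : taylor e = unit_seq n.
  rewrite te; apply/funext => m; rewrite /unit_seq ltnS.
  by case: leqP => // nm; rewrite gtn_eqF.
exists e; split=> // w wD; have [_ ew] := dirichlet_derive s1 e wD.
suff ew' : series (fun m => m.+1%:R * taylor e m.+1 * w ^+ m) @ \oo -->
    (n%:R * w ^+ n.-1 : C).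
  exact: (cvgC_unique ew ew').
have seriesE N : (n < N)%N ->
    series (fun m => m.+1%:R * taylor e m.+1 * w ^+ m) N = n%:R * w ^+ n.-1.
  rewrite /series/= te; case: n {te ew} => [|n] nN.
    by rewrite mul0r big1// => i _; rewrite /unit_seq mulr0 mul0r.
  rewrite (bigD1_seq n)/= ?iota_uniq ?mem_index_iota ?(ltnW nN)//.
  rewrite /unit_seq eqxx mulr1 big1 ?addr0// => i /negPf ni.
  by rewrite eqSS ni mulr0 mul0r.
apply: (@cvg_near_cst _ _ (n%:R * w ^+ n.-1 : C) _ \oo).
by near=> N; apply: seriesE; near: N; exact: nbhs_infty_gt.
Unshelve. all: by end_near. Qed.

(** The columns are the images of the monomials; by linearity, finite combinations of columns are
    images of polynomials. *)
Lemma comp_diff_matrix_exists alpha phi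
    (T : {linear dirichlet alpha -> dirichlet alpha}) :
  alpha < 1 -> (forall z : C, unit_disc z -> unit_disc (phi z : C)) ->
  represents_comp_diff phi T ->
  exists t, comp_diff_matrix phi t /\
    forall N x, exists f : dirichlet alpha,
      `|f| ^+ 2 <= weighted_sum alpha x 0 N /\ taylor (T f) = mapply t N x.
Proof.
move=> a1 phiD Tphi.
have [e eP] := choice (fun n => dirichlet_monomial n a1).
exists (fun k n => taylor (T (e n)) k); split=> [n z zD|N x].
  rewrite -(eP n).2; last exact: phiD.
  have := @taylorP _ _ (T (e n)) z zD; rewrite (Tphi _ _ zD); exact.
exists (\sum_(0 <= n < N) x n *: e n); split.
  have [g [_ tg gx]] := dirichlet_poly a1 N x.
  suff -> : \sum_(0 <= n < N) x n *: e n = g by [].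
  apply: (taylor_inj a1); apply/funext => k /=; rewrite taylor_sum tg.
  under eq_bigr do rewrite (eP _).1 /unit_seq.
  case: ltnP => kN.
    rewrite (bigD1_seq k)/= ?iota_uniq ?mem_index_iota//.
    by rewrite eqxx mulr1 big1 ?addr0// => i /negPf ni; rewrite eq_sym ni mulr0.
  rewrite big_nat big1// => i /andP[_ iN].
  by rewrite gtn_eqF ?mulr0// (leq_trans iN).
rewrite linear_sum/=; under eq_bigr do rewrite linearZ/=.
apply/funext => k; rewrite taylor_sum /mapply.
by apply: eq_bigr => n _; rewrite mulrC.
Qed.

Lemma comp_diff_matrix_decay alpha phi t (M : R) :
  0 < alpha < 1 -> 0 <= M -> comp_diff_matrix phi t ->
  (forall N x K, weighted_sum alpha (mapply t N x) 0 K <=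
     M * weighted_sum alpha x 0 N) ->
  exists D : R, forall k n, (k.+1 <= 2 * n.+1)%N ->
    normc (t k n) <= D / n.+1%:R ^+ 4.
Proof.
move=> /andP[a0 a1] M0 tphi tM.
(* [p m] lists the coefficients of [phi^m], recovered from column [m + 1], which belongs to
   [(m + 1) phi^m]. *)
pose p m k : R[i] := m.+1%:R^-1 * t k m.+1.
have pphi m : taylor_disc (fun z : C => phi z ^+ m : C) (p m).
  rewrite (_ : (fun z => _) = (fun z : C => m.+1%:R^-1 * (m.+1%:R * phi z ^+ m.+1.-1) : C)).
    exact: (@taylor_discZ _ _ _ _ (tphi m.+1)).
  by apply/funext => z /=; rewrite mulKf// pnatr_eq0.
have pM m K : \sum_(0 <= k < K) normc (p m k) ^+ 2 <=
    2 * M * m.+1%:R `^ (- (1 + alpha)).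
  (* The test input is [z^(m + 1)]: its weight is of order [(m + 1)^(1 - alpha)], and division by
     [(m + 1)^2] gives the exponent [- (1 + alpha)]. *)
  have := tM m.+2 (unit_seq m.+1) K.
  rewrite [X in _ <= _ * X -> _](_ : _ = dirichlet_weight alpha m.+1); last first.
    rewrite /weighted_sum big_nat_recr//= big1_seq ?add0r => [|i].
      by rewrite /unit_seq eqxx normc1 expr1n mulr1.
    rewrite mem_index_iota => /andP[_ /andP[_ im]].
    by rewrite /unit_seq ltn_eqF// normc0 expr0n mulr0.
  have tE k : mapply t m.+2 (unit_seq m.+1) k = t k m.+1.
    rewrite /mapply big_nat_recr//= big1_seq ?add0r => [|i].
      by rewrite /unit_seq eqxx mulr1.
    rewrite mem_index_iota => /andP[_ /andP[_ im]].
    by rewrite /unit_seq ltn_eqF// mulr0.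
  move=> tb.
  have wm : dirichlet_weight alpha m.+1 <= 2 * m.+1%:R `^ (1 - alpha).
    apply: (@le_trans _ _ ((2 * m.+1%:R) `^ (1 - alpha))).
      apply: ge0_ler_powR; rewrite ?nnegrE ?mulr_ge0 ?subr_ge0 ?(ltW a1)//.
      by rewrite -natrM ler_nat; lia.
    rewrite powRM// ler_wpM2r ?powR_ge0//; apply: ler1_powR; lra.
  apply: (@le_trans _ _ (m.+1%:R ^- 2 * (M * dirichlet_weight alpha m.+1))).
    apply: (le_trans _ (ler_wpM2l _ tb)); last by rewrite invr_ge0 exprn_ge0.
    rewrite mulr_sumr; apply: ler_sum => k _; rewrite tE /p normcM normcV normc_nat.
    rewrite exprMn exprVn ler_wpM2l ?invr_ge0 ?exprn_ge0//.
    by rewrite ler_peMl ?sqr_ge0// dirichlet_weight_ge1.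
  have -> : - (1 + alpha) = - 2%:R + (1 - alpha) by ring.
  rewrite powRD ?pnatr_eq0 ?implybT// powR_invn//.
  rewrite [leRHS](_ : _ = m.+1%:R ^- 2 * (M * (2 * m.+1%:R `^ (1 - alpha)))); last by ring.
  by rewrite ler_wpM2l ?invr_ge0 ?exprn_ge0// ler_wpM2l.
have pB m : coef_bounded (Num.sqrt (2 * M * m.+1%:R `^ (- (1 + alpha)))) (p m).
  move=> k; rewrite -[leLHS]ger0_norm ?normc_ge0// -sqrtr_sqr ler_wsqrtr//.
  apply: le_trans (pM m k.+1); rewrite big_nat_recr//= lerDr.
  by apply: sumr_ge0 => i _; exact: sqr_ge0.
have pD m n : p (m + n)%N = cauchy_prod (p m) (p n).
  apply: (taylor_disc_inj (pphi _)).
  have := taylor_discM (pB m) (pB n) (pphi m) (pphi n).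
  rewrite (_ : (fun z : C => phi z ^+ m * phi z ^+ n) = (fun z : C => phi z ^+ (m + n) : C)).
    exact.
  by apply/funext => z; rewrite exprD.
have a01 : 0 < alpha < 1 by rewrite a0.
have M2 : 0 <= 2 * M by rewrite mulr_ge0.
have [D D0 pn] := power_coef_decay a01 M2 pD pM.
(* Column 0 vanishes. Column [n + 1] carries a factor [n + 1], which costs one of the five powers;
   then [n + 2 <= 2 (n + 1)] accounts for [16 = 2^4]. *)
exists (16 * D) => k [|n] kn.
  have t0 : t ^~ 0%N = (fun=> 0).
    apply: (@taylor_disc0_inj C); have := tphi 0%N.
    by rewrite (_ : (fun z : C => 0%:R * _) = (fun=> 0))//; apply/funext => z; rewrite mul0r.
  have -> : t k 0%N = 0 by have /(congr1 (@^~ k)) := t0.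
  by rewrite normc0 divr_ge0 ?mulr_ge0// exprn_ge0.
have -> : normc (t k n.+1) = n.+1%:R * normc (p n k).
  by rewrite /p normcM normcV normc_nat mulVKf// pnatr_eq0.
apply: (@le_trans _ _ (n.+1%:R * (D / n.+1%:R ^+ 5))).
  by rewrite ler_wpM2l// pn//; lia.
rewrite (_ : n.+1%:R * _ = 16 * D / (2 * n.+1%:R) ^+ 4); last first.
  by field; rewrite nat1r pnatr_eq0.
rewrite ler_wpM2l ?mulr_ge0// lef_pV2 ?posrE ?exprn_gt0 ?mulr_gt0//.
by rewrite lerXn2r ?nnegrE ?mulr_ge0// -natrM ler_nat; lia.
Qed.

End CompDiffMatrix.

(** * Extension of the operator to the larger space *)

Lemma derive1_lin (K : numFieldType) (k : K) (f g : K -> K) (w : K) :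
  derivable f w 1 -> derivable g w 1 ->
  (fun z => k * f z + g z)^`()%classic w =
    k * f^`()%classic w + g^`()%classic w.
Proof.
move=> df dg; rewrite !derive1E.
rewrite (_ : (fun z => _) = (k *: (f : K -> K^o) + (g : K -> K^o)))//.
by rewrite deriveD ?deriveZ//; exact: derivableZ.
Qed.

Section Extension.
Context (R : realType).
Local Notation C := (R[i] : numFieldType).
Implicit Types (gamma : R) (phi : R[i] -> R[i]) (t : nat -> nat -> R[i]).

(** From [n = k] on, the pair [(k, n)] lies in the range of the decay hypothesis, which makes the
    series absolutely convergent. *)
Lemma mapply_cvg t (D X : R) (x : nat -> R[i]) k :
  (forall k n, (k.+1 <= 2 * n.+1)%N -> normc (t k n) <= D / n.+1%:R ^+ 4) ->
  coef_bounded X x ->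
  exists l : C, (fun N => mapply t N x k) @ \oo --> l.
Proof.
move=> tD xX; have X0 := coef_bounded_ge0 xX.
have D0 : 0 <= D.
  have := le_trans (normc_ge0 _) (tD 0%N 0%N isT).
  by rewrite expr1n divr1.
apply: (@cvgC_series _ (fun n => t k n * x n)
  (\sum_(0 <= n < k) normc (t k n * x n) + D * X * 2)) => N.
apply: (@le_trans _ _ (\sum_(0 <= n < k + N) normc (t k n * x n))).
  rewrite [leRHS](big_cat_nat (n := N))//= ?leq_addl// lerDl.
  by apply: sumr_ge0 => i _; exact: normc_ge0.
rewrite (big_cat_nat (n := k))//= ?leq_addr// lerD2l.
apply: (@le_trans _ _ (\sum_(0 <= n < k + N) D * X * n.+1%:R ^- 2)); last first.
  rewrite -mulr_sumr ler_wpM2l ?mulr_ge0//; exact: sum_inv_sqr_le.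
rewrite [leRHS](big_cat_nat (n := k))//= ?leq_addr//; apply: ler_wpDl.
  by apply: sumr_ge0 => i _; rewrite !mulr_ge0 ?invr_ge0 ?exprn_ge0.
rewrite big_nat [leRHS]big_nat; apply: ler_sum => n /andP[kn _].
rewrite normcM mulrAC; apply: ler_pM; rewrite ?normc_ge0//.
have kn2 : (k.+1 <= 2 * n.+1)%N by lia.
apply: (le_trans (tD _ _ kn2)).
rewrite ler_wpM2l// lef_pV2 ?posrE ?exprn_gt0//.
by rewrite ler_weXn2l ?ler1n.
Qed.

(** The truncations of [f] have images with uniformly bounded coefficients. These images converge
    coefficientwise by the decay of the matrix, and pointwise by the power series of [f'] at
    [phi z]; the two limits therefore match. *)
Lemma comp_diff_extend_fun gamma phi t (D c : R) (f : dirichlet gamma) :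
  gamma < 1 -> (forall z : C, unit_disc z -> unit_disc (phi z : C)) ->
  comp_diff_matrix phi t ->
  (forall k n, (k.+1 <= 2 * n.+1)%N -> normc (t k n) <= D / n.+1%:R ^+ 4) ->
  0 <= c -> (forall N x K, weighted_sum gamma (mapply t N x) 0 K <=
     c * weighted_sum gamma x 0 N) ->
  exists g : dirichlet gamma,
    (forall z : C, unit_disc z -> g z = comp_diff (phi : C -> C) (f : C -> C) z) /\
    forall k, (fun N => mapply t N (taylor f) k) @ \oo --> (taylor g k : C).
Proof.
move=> g1 phiD tphi tD c0 tc.
have [a ta] := choice (fun k => mapply_cvg k tD (coef_bounded_dirichlet g1 f)).
have tS N K : weighted_sum gamma (mapply t N (taylor f)) 0 K <= c * `|f| ^+ 2.
  apply: (le_trans (tc _ _ _)); rewrite ler_wpM2l//.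
  exact: weighted_sum_dirichlet_le.
have aS K : weighted_sum gamma a 0 K <= c * `|f| ^+ 2.
  by apply: (cvgC_weighted_sum_le ta); near=> N; exact: tS.
pose h_ N (z : C) : C := \sum_(0 <= n < N) taylor f n * (n%:R * phi z ^+ n.-1).
have h_t N : taylor_disc (h_ N) (mapply t N (taylor f)).
  elim: N => [|N IH].
    have -> : h_ 0%N = (fun=> 0) by apply/funext => z; rewrite /h_ big_geq.
    have -> : mapply t 0 (taylor f) = (fun=> 0).
      by apply/funext => k; rewrite /mapply big_geq.
    exact: taylor_disc0.
  have -> : h_ N.+1 = (fun z => h_ N z + taylor f N * (N%:R * phi z ^+ N.-1)).
    by apply/funext => z; rewrite /h_ big_nat_recr.
  have -> : mapply t N.+1 (taylor f) = (fun k => mapply t N (taylor f) k + taylor f N * t k N).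
    by apply/funext => k; rewrite /mapply big_nat_recr//= [t k N * _]mulrC.
  exact: (taylor_discD IH (@taylor_discZ _ _ _ _ (tphi N))).
have hB N := coef_bounded_weighted_sum g1 (tS N).
have h_lim (z : C) : unit_disc z ->
    h_ ^~ z @ \oo --> comp_diff (phi : C -> C) (f : C -> C) z.
  move=> zD; have [_ dz] := dirichlet_derive g1 f (phiD z zD).
  (* The term of index 0 vanishes, so [h_ N.+1 z] is the [N]-th partial sum of the series of [f'] at
     [phi z]. *)
  rewrite -(cvg_shiftS (fun N => h_ N z)).
  have -> : (fun N => h_ N.+1 z) =
    series (fun n => n.+1%:R * taylor f n.+1 * phi z ^+ n); last exact: dz.
  apply/funext => N; rewrite /h_ /series/= big_nat_recl//= mul0r mulr0 add0r.
  by apply: eq_bigr => n _; rewrite mulrA [_ * n.+1%:R]mulrC.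
have ht := taylor_disc_lim h_t hB ta h_lim.
have [g [gh tg _]] := dirichlet_of_taylor g1 ht aS.
exists g; split; first exact gh.
by move=> k; rewrite tg; exact: ta.
Unshelve. all: by end_near. Qed.

Lemma comp_diff_extend gamma phi t (D c : R) :
  gamma < 1 -> (forall z : C, unit_disc z -> unit_disc (phi z : C)) ->
  comp_diff_matrix phi t ->
  (forall k n, (k.+1 <= 2 * n.+1)%N -> normc (t k n) <= D / n.+1%:R ^+ 4) ->
  0 <= c -> (forall N x K, weighted_sum gamma (mapply t N x) 0 K <=
     c * weighted_sum gamma x 0 N) ->
  exists T : {linear dirichlet gamma -> dirichlet gamma},
    represents_comp_diff phi T /\
    forall (f : dirichlet gamma) k,
      (fun N => mapply t N (taylor f) k) @ \oo --> (taylor (T f) k : C).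
Proof.
move=> g1 phiD tphi tD c0 tc.
have [T TP] := choice (fun f => comp_diff_extend_fun f g1 phiD tphi tD c0 tc).
(* Agreement on the disc suffices, and there linearity is that of the derivative at [phi z]. *)
have T_lin : linear T.
  move=> k f g; apply: dirichlet_ext => z zD; rewrite (TP _).1//.
  have -> : (k *: T f + T g) z = k * T f z + T g z by [].
  rewrite (TP f).1// (TP g).1//.
  have [df _] := dirichlet_derive g1 f (phiD z zD).
  have [dg _] := dirichlet_derive g1 g (phiD z zD).
  exact (derive1_lin k df dg).
pose TL : {linear dirichlet gamma -> dirichlet gamma} :=
  HB.pack T (GRing.isLinear.Build _ _ _ _ T T_lin).
by exists TL; split=> [f z zD|f k]; [exact: (TP f).1|exact: (TP f).2].
Qed.

Lemma comp_diff_extend_sum_le gamma t (T : dirichlet gamma -> dirichlet gamma)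
    (c : R) L : 0 <= c ->
  (forall (f : dirichlet gamma) k,
      (fun N => mapply t N (taylor f) k) @ \oo --> (taylor (T f) k : C)) ->
  (forall N x K, weighted_sum gamma (mapply t N x) L K <=
     c * weighted_sum gamma x 0 N) ->
  forall f K, weighted_sum gamma (taylor (T f)) L K <= c * `|f| ^+ 2.
Proof.
move=> c0 tT tc f K; apply: (cvgC_weighted_sum_le (tT f)).
near=> N; apply: (le_trans (tc _ _ _)); rewrite ler_wpM2l//.
exact: weighted_sum_dirichlet_le.
Unshelve. all: by end_near. Qed.

End Extension.

(** * Precompactness as boundedness with uniformly small tails *)

Section Precompactness.
Context (R : realType).
Local Notation C := (R[i] : numFieldType).

(** Compactness of the segment provides a cluster point, and an ultrafilter converges to any of its
    cluster points. *)
Lemma ultra_cvg_bounded (T : Type) (U : set_system T) (u : T -> R) (B : R) :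
  UltraFilter U -> (\forall x \near U, `|u x| <= B) ->
  exists l : R, u @ U --> l.
Proof.
move=> UU uB.
have cB : compact `[- B, B] by exact: segment_compact.
have UuB : (u @ U) `[- B, B]%classic.
  by apply: filterS uB => x /=; rewrite in_itv/= ler_norml.
have [l [_ clu]] := cB _ _ UuB.
exists l => A lA; have [//|UA] := in_ultra_setVsetC (u @^-1` A) UU.
by have [y [/= yA /yA]] := clu (~` A) A UA lA.
Qed.

Lemma ultra_cvgC_bounded (T : Type) (U : set_system T) (u : T -> C) (B : R) :
  UltraFilter U -> (\forall x \near U, normc (u x) <= B) ->
  exists l : C, u @ U --> l.
Proof.
move=> UU uB.
have [|x xP] := @ultra_cvg_bounded _ U (fun t => complex.Re (u t)) B UU.
  by apply: filterS uB => t; apply: le_trans; exact: normc_Re.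
have [|y yP] := @ultra_cvg_bounded _ U (fun t => complex.Im (u t)) B UU.
  by apply: filterS uB => t; apply: le_trans; exact: normc_Im.
by exists (x +i* y); exact: cvgC_Re_Im xP yP.
Qed.

Context (s : R) (s1 : s < 1).
Implicit Types (A : set (dirichlet s)) (f g : dirichlet s).

Definition uniform_tails A := forall e : R, 0 < e ->
  exists L, forall f K, A f -> weighted_sum s (taylor f) L K <= e.

Lemma taylorB f g : taylor (f - g) = (fun n => taylor f n - taylor g n).
Proof.
rewrite (_ : f - g = (-1) *: g + f); last by rewrite scaleN1r addrC.
by rewrite taylor_linear; apply/funext => n; rewrite mulN1r addrC.
Qed.

Lemma weighted_sumB_le f g L K :
  weighted_sum s (taylor (f - g)) L K <=
    2 * weighted_sum s (taylor f) L K + 2 * weighted_sum s (taylor g) L K.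
Proof.
rewrite taylorB; exact: weighted_sum_seqB_le.
Qed.

Lemma weighted_sum_near f g (d : R) L K : `|f - g| <= d ->
  weighted_sum s (taylor g) L K <= 2 * weighted_sum s (taylor f) L K + 2 * d ^+ 2.
Proof.
move=> fgd; have {1}-> : g = f - (f - g) by rewrite opprB addrC subrK.
apply: (le_trans (weighted_sumB_le _ _ _ _)); rewrite lerD2l ler_wpM2l//.
apply: (le_trans (weighted_sum_dirichlet_le _ _ _)).
by rewrite lerXn2r ?nnegrE ?normr_ge0//; exact: le_trans fgd.
Qed.

Lemma dirichlet_tail f (e : R) : 0 < e ->
  exists L, forall K, weighted_sum s (taylor f) L K <= e.
Proof.
move=> e0; have cf := @cvg_dirichlet _ _ f.
have nd := @nondecreasing_dirichlet_series _ s (taylor f).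
have /cvgrPdist_le/(_ _ e0) := cf; move=> [L _ hL]; exists L => K.
have [LK|KL] := leqP L K; last by rewrite /weighted_sum big_geq ?(ltnW KL)// ltW.
have := hL L (leqnn _); rewrite /= ger0_norm ?subr_ge0; last first.
  exact: nondecreasing_cvgn_le.
apply: le_trans; rewrite lerBrDr.
apply: (@le_trans _ _ (dirichlet_series s (taylor f) K)).
  by rewrite [leRHS](big_cat_nat (n := L))//= addrC.
exact: nondecreasing_cvgn_le.
Qed.

(** Both conclusions come from the near-covering form of compactness: a property that holds near
    each point for all large parameters holds on the whole closure for one parameter. *)
Lemma precompact_uniform_tails A : precompact A ->
  uniform_tails A /\ exists B : R, forall f, A f -> `|f| <= B.
Proof.
rewrite precompactE => /compact_near_coveringP cA; split=> [e e0|].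
  have := cA nat \oo (fun L g => forall K, weighted_sum s (taylor g) L K <= e) _.
  case=> [f _|L _ /(_ L (leqnn _)) AL].
    have e4 : 0 < e / 4 by rewrite divr_gt0.
    have [L fL] := dirichlet_tail f e4.
    (* Half of [e] goes to the tail of [f] and half to the distance:
       [2 * (e / 4) + 2 * d ^+ 2 = e]. *)
    pose d := Num.sqrt (e / 4).
    have d0 : 0 < d by rewrite sqrtr_gt0.
    exists (ball f d, [set N | (L <= N)%N]).
      by split; [exact: nbhsx_ballx|exact: nbhs_infty_ge].
    move=> [g N]/= [fg LN] K; rewrite -ball_normE/= in fg.
    apply: (le_trans (weighted_sum_near _ _ (ltW fg))).
    rewrite /d sqr_sqrtr ?(ltW e4)//.
    suff : weighted_sum s (taylor f) N K <= e / 4 by lra.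
    apply: le_trans (fL K).
    have [NK|KN] := leqP N K; last first.
      by rewrite /weighted_sum big_geq ?(ltnW KN)// weighted_sum_ge0.
    rewrite [leRHS](big_cat_nat (n := N))//= lerDr.
    exact: weighted_sum_ge0.
  by exists L => f K Af; apply: AL; exact: subset_closure.
have := cA R +oo (fun B g => `|g| <= B) _.
case=> [f _|B [_ AB]].
  exists (ball f 1, [set B | `|f| + 1 <= B]).
    by split; [exact: nbhsx_ballx|exact: nbhs_pinfty_ge].
  move=> [g B]/= [fg fB]; rewrite -ball_normE in fg.
  have gf : `|g - f| < 1 by rewrite distrC; exact fg.
  have gB : `|g| <= `|g - f| + `|f| by have h := ler_normD (g - f) f; rewrite subrK in h.
  have h := lerD (ltW gf) (lexx `|f|); rewrite [1 + _]addrC in h.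
  exact (le_trans gB (le_trans h fB)).
exists (B + 1) => f Af; apply: (AB (B + 1)); first by rewrite ltrDl.
exact: subset_closure.
Qed.

(** Along an ultrafilter on the closure every coefficient converges, by boundedness. The limits
    define an element of the space, and the uniform tails upgrade coefficientwise convergence to
    convergence in norm. *)
Lemma uniform_tails_precompact A (B : R) :
  uniform_tails A -> (forall f, A f -> `|f| <= B) -> precompact A.
Proof.
move=> At AB; rewrite precompactE compact_ultra => U UU UcA.
have cAP f (d : R) : closure A f -> 0 < d -> exists2 g, A g & `|g - f| <= d.
  move=> Af d0; have [g [Ag fg]] := Af _ (nbhsx_ballx f d d0).
  exists g; first exact Ag.
  by rewrite -ball_normE in fg; rewrite distrC; exact: ltW fg.
have cAt : uniform_tails (closure A).
  move=> e e0; have e4 : 0 < e / 4 by rewrite divr_gt0.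
  have [L AL] := At _ e4; exists L => f K cAf.
  have d0 : 0 < Num.sqrt (e / 4) by rewrite sqrtr_gt0.
  have [g Ag gf] := cAP _ _ cAf d0.
  apply: (le_trans (weighted_sum_near _ _ gf)); rewrite sqr_sqrtr ?(ltW e4)//.
  have := AL g K Ag; lra.
have cAB f : closure A f -> `|f| <= B + 1.
  move=> cAf; have [g Ag gf] := cAP _ _ cAf ltr01.
  rewrite -[f](subrK g) addrC; apply: (le_trans (ler_normD _ _)).
  by apply: lerD; [exact: AB|rewrite distrC].
have Uk k : exists l : C, (fun f => taylor f k : C) @ U --> l.
  apply: (@ultra_cvgC_bounded _ _ _ (B + 1)); apply: filterS UcA => f cAf.
  exact: le_trans (coef_bounded_dirichlet s1 f k) (cAB _ cAf).
have [a Ua] := choice Uk.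
have tail_a L K (S : R) : (forall f, closure A f -> weighted_sum s (taylor f) L K <= S) ->
    weighted_sum s a L K <= S.
  by move=> fS; apply: (cvgC_weighted_sum_le Ua); apply: filterS UcA => f; exact: fS.
have aB K : weighted_sum s a 0 K <= (B + 1) ^+ 2.
  apply: tail_a => f cAf; apply: (le_trans (weighted_sum_dirichlet_le _ _ _)).
  by rewrite lerXn2r ?nnegrE ?normr_ge0 ?cAB//; exact: le_trans (cAB _ cAf).
have [h ha] := taylor_disc_exists (coef_bounded_weighted_sum s1 aB).
have [p [_ tp _]] := dirichlet_of_taylor s1 ha aB.
suff Up : U --> p.
  exists p; split; last exact Up.
  apply: (@closed_closure _ A) => N pN.
  exact: (filter_ex (filterI UcA (Up _ pN))).
apply/cvgrPdist_le => e e0.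
(* The head contributes at most [d] and the tail at most [2 * d + 2 * d]. *)
pose d := e ^+ 2 / 5.
have d0 : 0 < d by rewrite divr_gt0// exprn_gt0.
have [L cAL] := cAt _ d0.
have near_head : \forall f \near U, weighted_sum s (taylor (p - f)) 0 L <= d.
  have hc : (fun f => weighted_sum s (taylor (p - f)) 0 L) @ U --> (0 : R).
    rewrite [X in _ --> X](_ : 0 = \sum_(0 <= k < L) dirichlet_weight s k * (0 * 0)); last first.
      by rewrite big1// => i _; rewrite !mulr0.
    apply: cvg_big => [|k _]; first exact: add_continuous.
    apply: cvgM; first exact: cvg_cst.
    have /cvgC_norm c := Ua k.
    under eq_cvg do rewrite taylorB tp.
    by apply: cvgM; exact: c.
  have /cvgrPdist_le/(_ _ d0) := hc; apply: filterS => f.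
  by rewrite sub0r normrN; apply: le_trans; exact: ler_norm.
apply: filterS2 near_head UcA => f hf cAf.
rewrite -(@ler_pXn2r _ 2)// ?nnegrE ?normr_ge0 ?(ltW e0)//.
apply: dirichlet_norm_sqr_le => K.
have arith4 (x y : R) : x <= d -> y <= d -> 2 * x + 2 * y <= 4 * d by lra.
have arith5 (x y : R) : x <= d -> y <= 4 * d -> x + y <= e ^+ 2 by rewrite /d; lra.
have tl M : weighted_sum s (taylor (p - f)) L M <= 4 * d.
  have h1 := cAL f M cAf.
  have h2 : weighted_sum s (taylor p) L M <= d.
    by rewrite tp; apply: tail_a => g cAg; exact: (cAL g M cAg).
  exact: (le_trans (weighted_sumB_le p f L M) (arith4 _ _ h2 h1)).
apply: le_trans (arith5 _ _ hf (tl (maxn L K))).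
move: (taylor (p - f)) => b.
rewrite -[leRHS](big_cat_nat (n := L))//= ?leq_maxl//.
rewrite [leRHS](big_cat_nat (n := K))//= ?leq_maxr// lerDl.
exact: weighted_sum_ge0.
Qed.

End Precompactness.

(** * Transfer of boundedness and compactness from [alpha] to [gamma] *)

Section Transfer.
Context (R : realType).
Local Notation C := (R[i] : numFieldType).
Implicit Types (alpha gamma : R) (phi : R[i] -> R[i]).

Lemma weighted_sumZ s (k : R[i]) (a : nat -> R[i]) L K :
  weighted_sum s (fun n => k * a n) L K = normc k ^+ 2 * weighted_sum s a L K.
Proof.
rewrite /weighted_sum mulr_sumr; apply: eq_bigr => n _.
by rewrite normcM exprMn mulrCA.
Qed.

Lemma taylorZ s (k : R[i]) (f : dirichlet s) :
  taylor (k *: f) = (fun n => k * taylor f n).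
Proof.
apply: (@taylorE _ _ (k *: f)); exact (@taylor_discZ _ k _ _ (@taylorP _ _ f)).
Qed.

(** Rescaling by [1 / |f|], viewed in [R[i]], extends to all [f] the estimates that compactness
    gives on the unit ball. *)
Lemma weighted_sum_homogeneous s (T : {linear dirichlet s -> dirichlet s})
    (E : R) L K :
  (forall f, `|f| <= 1 -> weighted_sum s (taylor (T f)) L K <= E) ->
  forall f, weighted_sum s (taylor (T f)) L K <= E * `|f| ^+ 2.
Proof.
move=> TE f; have [->|f0] := eqVneq f 0.
  have -> : taylor (T 0) = (fun n => 0 * taylor (T 0) n).
    by rewrite -taylorZ scale0r linear0.
  by rewrite weighted_sumZ normc0 normr0 !expr0n/= mul0r mulr0.
have nf0 : 0 < `|f| by rewrite normr_gt0.
pose k : R[i] := (`|f|^-1)%:C.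
have nk : normc k = `|f|^-1 by rewrite normc_real ger0_norm ?invr_ge0.
have kf : `|k *: f| <= 1.
  have -> : `|k *: f| = normc k * `|f| by exact: dirichlet_normZ.
  by rewrite nk mulVf ?gt_eqF.
have := TE _ kf; rewrite linearZ taylorZ weighted_sumZ nk exprVn.
by rewrite mulrC ler_pdivrMr ?exprn_gt0.
Qed.

(** [S] and [c] are fixed before [L] and [E], so one estimate gives boundedness with [L = 0] and
    small tails with [L] large and [E] small. *)
Lemma comp_diff_transfer alpha gamma phi
    (T : {linear dirichlet alpha -> dirichlet alpha}) (M : R) :
  0 < alpha -> alpha < gamma < 1 ->
  (forall z : C, unit_disc z -> unit_disc (phi z : C)) ->
  represents_comp_diff phi T -> 0 <= M ->
  (forall f K, weighted_sum alpha (taylor (T f)) 0 K <= M * `|f| ^+ 2) ->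
  exists (S : {linear dirichlet gamma -> dirichlet gamma}) (c : R),
    [/\ represents_comp_diff phi S, 0 <= c &
      forall L E, 0 <= E ->
      (forall f K, weighted_sum alpha (taylor (T f)) L K <= E * `|f| ^+ 2) ->
      forall f K, weighted_sum gamma (taylor (S f)) L K <=
        c * (E + L.+1%:R^-1) * `|f| ^+ 2].
Proof.
move=> a0 ag1 phiD Tphi M0 TM; have /andP[ag g1] := ag1.
have a1 : alpha < 1 by exact: lt_trans g1.
have [t [tphi tT]] := comp_diff_matrix_exists a1 phiD Tphi.
have tE L E : 0 <= E ->
    (forall f K, weighted_sum alpha (taylor (T f)) L K <= E * `|f| ^+ 2) ->
    forall N x K, weighted_sum alpha (mapply t N x) L K <= E * weighted_sum alpha x 0 N.
  move=> E0 TE N x K; have [f [fx <-]] := tT N x.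
  by apply: (le_trans (TE f K)); rewrite ler_wpM2l.
have a01 : 0 < alpha < 1 by rewrite a0.
have [D tD] := comp_diff_matrix_decay a01 M0 tphi (tE 0%N M M0 TM).
have [c c0 tc] := weighted_sum_interpolation a0 ag1 tD.
have cE L E : 0 <= E -> 0 <= c * (E + L.+1%:R^-1).
  by move=> E0; rewrite mulr_ge0// addr_ge0// invr_ge0.
have [S [Sphi St]] := comp_diff_extend g1 phiD tphi tD (cE 0%N M M0)
  (tc 0%N M M0 (tE 0%N M M0 TM)).
exists S, c; split; [exact Sphi|exact c0|move=> L E E0 TE].
exact: (comp_diff_extend_sum_le (cE L E E0) St (tc L E E0 (tE L E E0 TE))).
Qed.

Lemma comp_diff_bounded_transfer alpha gamma phi : 0 < alpha ->
  alpha < gamma < 1 -> (forall z : C, unit_disc z -> unit_disc (phi z : C)) ->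
  comp_diff_bounded alpha phi -> comp_diff_bounded gamma phi.
Proof.
move=> a0 ag1 phiD [T Tphi [M TM]].
(* [M ^+ 2] is nonnegative whatever the sign of [M]. *)
have TM' f K : weighted_sum alpha (taylor (T f)) 0 K <= M ^+ 2 * `|f| ^+ 2.
  apply: (le_trans (weighted_sum_dirichlet_le _ _ _)).
  have := TM f; rewrite -exprMn => h.
  by rewrite lerXn2r ?nnegrE ?(le_trans (normr_ge0 _) h).
have [S [c [Sphi c0 SE]]] := comp_diff_transfer a0 ag1 phiD Tphi (sqr_ge0 M) TM'.
exists S; first exact Sphi.
(* The summand 1 is [1 / (L + 1)] at [L = 0]. *)
exists (Num.sqrt (c * (M ^+ 2 + 1))) => f.
have h : `|S f| ^+ 2 <= c * (M ^+ 2 + 1) * `|f| ^+ 2.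
  apply: dirichlet_norm_sqr_le => K; rewrite -[X in _ + X]invr1.
  exact: (SE 0%N _ (sqr_ge0 M) TM').
have c1 : 0 <= c * (M ^+ 2 + 1) by rewrite mulr_ge0// addr_ge0// sqr_ge0.
rewrite -(@ler_pXn2r _ 2)// ?nnegrE ?mulr_ge0 ?sqrtr_ge0 ?normr_ge0//.
have -> : (Num.sqrt (c * (M ^+ 2 + 1)) * `|f|) ^+ 2 = c * (M ^+ 2 + 1) * `|f| ^+ 2.
  rewrite exprMn; congr (_ * _); exact: sqr_sqrtr.
exact h.
Qed.

Lemma comp_diff_compact_transfer alpha gamma phi : 0 < alpha ->
  alpha < gamma < 1 -> (forall z : C, unit_disc z -> unit_disc (phi z : C)) ->
  comp_diff_compact alpha phi -> comp_diff_compact gamma phi.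
Proof.
move=> a0 ag1 phiD [T Tphi Tcpt]; have /andP[ag g1] := ag1.
have ball_bounded : bounded_set [set f : dirichlet alpha | `|f| <= 1].
  exists 1; split; first exact: num_real.
  by move=> B B1 f /= f1; exact: (le_trans f1 (ltW B1)).
have [Ttails [B TB]] := precompact_uniform_tails (Tcpt _ ball_bounded).
have TM : forall f K, weighted_sum alpha (taylor (T f)) 0 K <= B ^+ 2 * `|f| ^+ 2.
  move=> f K; move: f; apply: weighted_sum_homogeneous => f f1.
  apply: (le_trans (weighted_sum_dirichlet_le _ _ _)).
  have h : `|T f| <= B by apply: TB; exists f.
  by rewrite lerXn2r ?nnegrE ?(le_trans (normr_ge0 _) h).
have [S [c [Sphi c0 SE]]] := comp_diff_transfer a0 ag1 phiD Tphi (sqr_ge0 B) TM.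
exists S; first exact Sphi.
move=> A [X [_ AX]].
(* [bounded_set] bounds [A] by every number above [X], whose sign is unknown; [|X| + 1] is such a
   number and is positive. *)
have {}AX f : A f -> `|f| ^+ 2 <= (`|X| + 1) ^+ 2.
  move=> Af; have h : `|f| <= `|X| + 1.
    by apply: (AX (`|X| + 1)) => //; rewrite (le_lt_trans (ler_norm X))// ltrDl.
  by rewrite lerXn2r ?nnegrE ?normr_ge0// addr_ge0.
set Y := (`|X| + 1) ^+ 2 in AX.
have Y0 : 0 < Y by rewrite exprn_gt0// ltr_wpDl.
pose b := Num.sqrt (c * (B ^+ 2 + 1) * Y).
have c1 : 0 <= c * (B ^+ 2 + 1) by rewrite mulr_ge0// addr_ge0// sqr_ge0.
have cY : 0 <= c * (B ^+ 2 + 1) * Y by rewrite mulr_ge0// ltW.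
apply: (@uniform_tails_precompact _ _ g1 _ b); last first.
  move=> _ [f Af <-]; rewrite -(@ler_pXn2r _ 2)// ?nnegrE ?sqrtr_ge0 ?normr_ge0//.
  have -> : b ^+ 2 = c * (B ^+ 2 + 1) * Y by exact: sqr_sqrtr.
  apply: (@le_trans _ _ (c * (B ^+ 2 + 1) * `|f| ^+ 2)); last first.
    by apply: ler_wpM2l => //; exact: AX.
  apply: dirichlet_norm_sqr_le => K; rewrite -[X in _ + X]invr1.
  exact: (SE 0%N _ (sqr_ge0 B) TM).
(* The final bound is [c * (d + d) * Y], that is [c / (c + 1) * e]; [c + 1] avoids a division by
   zero. *)
move=> e e0; pose d := e / (2 * (c + 1) * Y).
have d0 : 0 < d by rewrite divr_gt0// !mulr_gt0// ltr_wpDl.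
have [L0 TL0] := Ttails _ d0.
(* [L] is at least the tail index [L0] on the unit ball and at least [1 / d], so both [E = d] and
   [1 / (L + 1) <= d] are available. *)
pose L := maxn L0 (Num.bound d^-1).
have Ld : L.+1%:R^-1 <= d.
  rewrite -[leRHS]invrK lef_pV2 ?posrE ?invr_gt0//.
  apply: (le_trans (ltW (archi_boundP _))); first by rewrite invr_ge0 ltW.
  by rewrite ler_nat leqW// leq_maxr.
have TL : forall f K, weighted_sum alpha (taylor (T f)) L K <= d * `|f| ^+ 2.
  move=> f K; move: f; apply: weighted_sum_homogeneous => f f1.
  apply: (@le_trans _ _ (weighted_sum alpha (taylor (T f)) L0 K)); last first.
    by apply: TL0; exists f.
  have [LK|KL] := leqP L K; last first.
    by rewrite [leLHS]big_geq ?(ltnW KL)//; exact: weighted_sum_ge0.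
  rewrite [leRHS](big_cat_nat (n := L))//= ?leq_maxl// lerDr.
  exact: weighted_sum_ge0.
exists L => _ K [f Af <-].
apply: (le_trans (SE L d (ltW d0) TL f K)).
apply: (@le_trans _ _ (c * (d + d) * Y)).
  apply: ler_pM; rewrite ?AX ?exprn_ge0//.
    by rewrite mulr_ge0// addr_ge0 ?invr_ge0// ltW.
  by rewrite ler_wpM2l// lerD2l.
have c10 : 0 < c + 1 by rewrite ltr_wpDl.
rewrite (_ : c * (d + d) * Y = c / (c + 1) * e); last first.
  by rewrite /d; field; rewrite !gt_eqF.
by rewrite ler_piMl ?(ltW e0)// ler_pdivrMr// mul1r lerDl.
Qed.

End Transfer.

Theorem proposition3p9 (R : realType) (phi : R[i] -> R[i])
    (hphi : holomorphic_self_map phi) :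
  (forall alpha : R, 0 < alpha < 1 -> comp_diff_bounded alpha phi ->
     forall gamma : R, alpha < gamma < 1 -> comp_diff_bounded gamma phi) /\
  (forall alpha : R, 0 < alpha < 1 -> comp_diff_compact alpha phi ->
     forall gamma : R, alpha < gamma < 1 -> comp_diff_compact gamma phi).
Proof.
have [_ phiD] := hphi.
split=> alpha /andP[a0 _] Tphi gamma ag1.
  exact: (comp_diff_bounded_transfer a0 ag1 phiD Tphi).
exact: (comp_diff_compact_transfer a0 ag1 phiD Tphi).
Qed.
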